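(* The following assertions hold: (i) Let $R$ be an almost clean coherent arithmetical ring. Assume that for every $x\in\mathrm{pSpec}\ R$ the ring $R/A(x)$ is either a torch ring, or local, or a domain. Then $R$ is finitely fractionally IF. (ii) Each clean coherent arithmetical ring is finitely fractionally IF. (iii) Each semihereditary ring is finitely fractionally IF. (iv) Let $R$ be a ring of Krull dimension zero or a domain of Krull dimension one. Then $R$ is finitely fractionally IF if and only if $R$ is coherent and arithmetical.
   Context: All rings are commutative with unity. A ring is clean (respectively almost clean) if each element is the sum of an idempotent and a unit (respectively of an idempotent and a regular element, i.e. a non-zero-divisor). A module is uniserial if its submodules are totally ordered by inclusion; a valuation ring is a ring that is uniserial as a module over itself; $R$ is arithmetical if $R_L$ is a valuation ring for each maximal ideal $L$. A ring is semihereditary if each finitely generated ideal is projective. A torch ring is an arithmetical ring with at least two maximal ideals that has a unique minimal prime ideal $N$, where $N$ is a nonzero uniserial module. $Q(S)$ denotes the classical (total) ring of quotients of $S$. A ring is an IF-ring if each of its injective modules is flat. $R$ is finitely fractionally IF if $Q(R/A)$ is an IF-ring for each finitely generated ideal $A$ of $R$. $V(A)=\{P\in\mathrm{Spec}\ R\mid A\subseteq P\}$. $\mathrm{pSpec}\ R$ is the quotient space of $\mathrm{Spec}\ R$ (Zariski topology) by the equivalence relation generated by inclusion of primes: $L\sim L'$ if there is a finite sequence of primes $L=L_1,\dots,L_n=L'$ with $L_k\subseteq L_{k+1}$ or $L_k\supseteq L_{k+1}$ for each $k<n$; its points $x$ are regarded as subsets of $\mathrm{Spec}\ R$. An ideal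 $A$ is pure if $R/A$ is flat over $R$. If $\{x\}$ is closed in $\mathrm{pSpec}\ R$, $A(x)$ denotes the unique pure ideal with $x=V(A(x))$; explicitly $A(x)=\bigcap_{P\in x}\ker(R\to R_P)$. (When $R$ is almost clean every point of $\mathrm{pSpec}\ R$ is closed.) *)

(* Defs.v *)
From HB Require Import structures.
From mathcomp Require Import all_boot all_algebra generic_quotient ring_quotient ring.
From mathcomp Require Import boolp.

Set Implicit Arguments.
Unset Strict Implicit.
Unset Printing Implicit Defensive.

Import GRing.Theory.

Local Open Scope quotient_scope.
Local Open Scope ring_scope.

(* Rings are [comPzRingType]s, so that the zero ring is allowed: quotients by
   an improper ideal have to be covered, whereas the ideals and quotient rings
   of [ring_quotient] are restricted to proper ideals of nonzero rings. *)

(** * Submodules and ideals *)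

Record submod (R : pzRingType) (M : lmodType R) := Submod {
  submod_set :> M -> Prop;
  submod0 : submod_set 0;
  submodD : forall x y, submod_set x -> submod_set y -> submod_set (x + y);
  submodZ : forall (a : R) x, submod_set x -> submod_set (a *: x)
}.

Section SubmodType.
Context (R : pzRingType) (M : lmodType R) (N : submod M).

Definition submod_pred : {pred M} := fun x => `[< N x >].

Lemma submod_predP x : reflect (N x) (x \in submod_pred).
Proof. exact: asboolP. Qed.

Lemma submod_pred_closed : submod_closed submod_pred.
Proof.
split; first exact/submod_predP/submod0.
move=> a x y /submod_predP Nx /submod_predP Ny.
by apply/submod_predP/submodD/Ny/submodZ.
Qed.

HB.instance Definition _ := GRing.isSubmodClosed.Build R M submod_pred
  (GRing.submod_closed_semi submod_pred_closed).

(* The submodule [N], as a module. *)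
Record submod_type := SubmodElt {
  submod_val : M; submod_valP : submod_val \in submod_pred }.

HB.instance Definition _ := [isSub for submod_val].
HB.instance Definition _ := [Choice of submod_type by <:].
HB.instance Definition _ := [SubChoice_isSubLmodule of submod_type by <:].

End SubmodType.

Notation ideal R := (submod R^o).

(** * Quotient rings *)

Section RingQuot.
Context (R : comPzRingType) (I : ideal R).

Definition ring_quot : Type := Quotient.quot (submod_pred I).

HB.instance Definition _ := GRing.Zmodule.on ring_quot.
HB.instance Definition _ :=
  EqQuotient.copy ring_quot (Quotient.quot (submod_pred I)).

Definition quot_pi (x : R) : ring_quot := \pi_ring_quot (x : R^o).

Lemma quot_piP x y : quot_pi x = quot_pi y <-> I (x - y).
Proof.
split=> [/eqP|Ixy]; first by rewrite piE => /submod_predP.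
by apply/eqP; rewrite piE; apply/submod_predP.
Qed.

Definition quot_one : ring_quot := quot_pi 1.
Definition quot_mul (x y : ring_quot) : ring_quot :=
  quot_pi ((repr x : R) * (repr y : R)).

Lemma quot_piK (x : ring_quot) : quot_pi (repr x) = x.
Proof. exact: reprK. Qed.

Lemma quot_pi_mul x y : quot_mul (quot_pi x) (quot_pi y) = quot_pi (x * y).
Proof.
apply/quot_piP; set x' : R := repr _; set y' : R := repr _.
have Ix : I (x' - x) by apply/quot_piP; rewrite quot_piK.
have Iy : I (y' - y) by apply/quot_piP; rewrite quot_piK.
have -> : x' * y' - x * y = y' * (x' - x) + x * (y' - y).
  by rewrite !mulrBr addrA [y' * x']mulrC [y' * x]mulrC addrNK.
by apply: submodD; apply: (submodZ (s := I)).
Qed.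

Lemma quot_mulA : associative quot_mul.
Proof.
move=> x y z; rewrite -[x]quot_piK -[y]quot_piK -[z]quot_piK.
by rewrite !quot_pi_mul mulrA.
Qed.

Lemma quot_mulC : commutative quot_mul.
Proof.
by move=> x y; rewrite -[x]quot_piK -[y]quot_piK !quot_pi_mul mulrC.
Qed.

Lemma quot_mul1 : left_id quot_one quot_mul.
Proof. by move=> x; rewrite -[x]quot_piK quot_pi_mul mul1r. Qed.

Lemma quot_piD x y : quot_pi (x + y) = quot_pi x + quot_pi y.
Proof. exact: Quotient.pi_add. Qed.

Lemma quot_mulDl : left_distributive quot_mul +%R.
Proof.
move=> x y z; rewrite -[x]quot_piK -[y]quot_piK -[z]quot_piK.
by rewrite -quot_piD !quot_pi_mul mulrDl quot_piD.
Qed.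

HB.instance Definition _ := GRing.Zmodule_isComPzRing.Build ring_quot
  quot_mulA quot_mulC quot_mul1 quot_mulDl.

Lemma quot_pi_is_zmod_morphism : zmod_morphism quot_pi.
Proof.
move=> x y; rewrite quot_piD; congr (_ + _).
exact: (Quotient.pi_opp (submod_pred I)).
Qed.

Lemma quot_pi_is_monoid_morphism : monoid_morphism quot_pi.
Proof. by split=> // x y; rewrite -quot_pi_mul. Qed.

HB.instance Definition _ :=
  GRing.isZmodMorphism.Build R ring_quot quot_pi quot_pi_is_zmod_morphism.
HB.instance Definition _ :=
  GRing.isMonoidMorphism.Build R ring_quot quot_pi quot_pi_is_monoid_morphism.

End RingQuot.

(** * Rings of fractions *)

Record mulset (R : comPzRingType) := Mulset {
  mulset_set :> R -> Prop;
  mulset1 : mulset_set 1;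
  mulsetM : forall s t, mulset_set s -> mulset_set t -> mulset_set (s * t)
}.

Section Loc.
Context (R : comPzRingType) (S : mulset R).

Definition denom := {s : R | `[< S s >]}.

Definition mk_denom s (Ss : S s) : denom := exist _ s (asboolT Ss).

Lemma denomP (s : denom) : S (sval s). Proof. exact: asboolW (valP s). Qed.

Definition denom1 : denom := mk_denom (mulset1 S).
Definition denomM (s t : denom) : denom :=
  mk_denom (mulsetM (denomP s) (denomP t)).

Definition loc_eq (x y : R * denom) : bool :=
  `[< exists2 u, S u & u * (x.1 * sval y.2 - y.1 * sval x.2) = 0 >].

Lemma loc_eqP x y : reflect
  (exists2 u, S u & u * (x.1 * sval y.2) = u * (y.1 * sval x.2)) (loc_eq x y).
Proof.
apply: (iffP (asboolP _)) => -[u Su E]; exists u => //.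
  by apply/subr0_eq; rewrite -mulrBr.
by rewrite mulrBr E subrr.
Qed.

Lemma loc_eq_equiv : equiv_class_of loc_eq.
Proof.
have sym x y : loc_eq x y -> loc_eq y x.
  by case/loc_eqP=> u Su E; apply/loc_eqP; exists u.
split=> [x|x y|y x z].
- by apply/loc_eqP; exists 1 => //; apply: mulset1.
- by apply/idP/idP; apply: sym.
case/loc_eqP=> u Su Eu /loc_eqP[v Sv Ev]; apply/loc_eqP.
exists (u * v * sval y.2); first by do ?apply: mulsetM => //; apply: denomP.
transitivity (v * sval z.2 * (u * (x.1 * sval y.2))); first by ring.
rewrite Eu; transitivity (u * sval x.2 * (v * (y.1 * sval z.2))); first by ring.
by rewrite Ev; ring.
Qed.

Canonical loc_equiv := EquivRelPack loc_eq_equiv.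
Canonical loc_encModRel := defaultEncModRel loc_eq.

Definition loc : Type := {eq_quot loc_eq}.

HB.instance Definition _ := Choice.on loc.
HB.instance Definition _ := EqQuotient.on loc.

(* The fraction [a / s]. *)
Definition frac (a : R) (s : denom) : loc := \pi_loc (a, s).

Lemma fracP a s b t : frac a s = frac b t <->
  exists2 u, S u & u * (a * sval t) = u * (b * sval s).
Proof.
by split=> [/eqP|E]; [|apply/eqP]; rewrite ?piE; [move/loc_eqP | apply/loc_eqP].
Qed.

Lemma frac_repr (x : loc) : frac (repr x).1 (repr x).2 = x.
Proof. by rewrite /frac -surjective_pairing; apply: reprK. Qed.

Lemma frac_surj (x : loc) : exists a s, x = frac a s.
Proof. by exists (repr x).1, (repr x).2; rewrite frac_repr. Qed.

Definition loc_add (x y : loc) : loc :=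
  frac ((repr x).1 * sval (repr y).2 + (repr y).1 * sval (repr x).2)
       (denomM (repr x).2 (repr y).2).
Definition loc_mul (x y : loc) : loc :=
  frac ((repr x).1 * (repr y).1) (denomM (repr x).2 (repr y).2).
Definition loc_opp (x : loc) : loc := frac (- (repr x).1) (repr x).2.

Lemma loc_addE a s b t : loc_add (frac a s) (frac b t) =
  frac (a * sval t + b * sval s) (denomM s t).
Proof.
have [[u Su Eu] [v Sv Ev]] :=
  (proj1 (fracP _ _ _ _) (frac_repr (frac a s)),
   proj1 (fracP _ _ _ _) (frac_repr (frac b t))).
apply/fracP; exists (u * v); first exact: mulsetM.
move: (repr _) (repr _) Eu Ev => [b' t'] [a' s'] /= Eu Ev.
transitivity (sval t * sval t' * v * (u * (a' * sval s))
              + sval s * sval s' * u * (v * (b' * sval t))); first by ring.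
by rewrite Eu Ev; ring.
Qed.

Lemma loc_mulE a s b t :
  loc_mul (frac a s) (frac b t) = frac (a * b) (denomM s t).
Proof.
have [[u Su Eu] [v Sv Ev]] :=
  (proj1 (fracP _ _ _ _) (frac_repr (frac a s)),
   proj1 (fracP _ _ _ _) (frac_repr (frac b t))).
apply/fracP; exists (u * v); first exact: mulsetM.
move: (repr _) (repr _) Eu Ev => [b' t'] [a' s'] /= Eu Ev.
transitivity ((u * (a' * sval s)) * (v * (b' * sval t))); first by ring.
by rewrite Eu Ev; ring.
Qed.

Lemma loc_oppE a s : loc_opp (frac a s) = frac (- a) s.
Proof.
have [u Su Eu] := proj1 (fracP _ _ _ _) (frac_repr (frac a s)).
apply/fracP; exists u => //.
by rewrite !mulNr !mulrN Eu.
Qed.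

Lemma frac_eq a s b t : a * sval t = b * sval s -> frac a s = frac b t.
Proof. by move=> E; apply/fracP; exists 1; [apply: mulset1 | rewrite E]. Qed.

Lemma loc_addA : associative loc_add.
Proof.
move=> x y z; have [[[a [s ->]] [b [t ->]]] [c [r ->]]] :=
  (frac_surj x, frac_surj y, frac_surj z).
by rewrite !loc_addE; apply: frac_eq => /=; ring.
Qed.

Lemma loc_addC : commutative loc_add.
Proof.
move=> x y; have [[a [s ->]] [b [t ->]]] := (frac_surj x, frac_surj y).
by rewrite !loc_addE; apply: frac_eq => /=; ring.
Qed.

Lemma loc_add0 : left_id (frac 0 denom1) loc_add.
Proof.
move=> x; have [a [s ->]] := frac_surj x.
by rewrite loc_addE; apply: frac_eq => /=; ring.
Qed.

Lemma loc_addN : left_inverse (frac 0 denom1) loc_opp loc_add.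
Proof.
move=> x; have [a [s ->]] := frac_surj x.
by rewrite loc_oppE loc_addE; apply: frac_eq => /=; ring.
Qed.

HB.instance Definition _ :=
  GRing.isZmodule.Build loc loc_addA loc_addC loc_add0 loc_addN.

Lemma loc_mulA : associative loc_mul.
Proof.
move=> x y z; have [[[a [s ->]] [b [t ->]]] [c [r ->]]] :=
  (frac_surj x, frac_surj y, frac_surj z).
by rewrite !loc_mulE; apply: frac_eq => /=; ring.
Qed.

Lemma loc_mulC : commutative loc_mul.
Proof.
move=> x y; have [[a [s ->]] [b [t ->]]] := (frac_surj x, frac_surj y).
by rewrite !loc_mulE; apply: frac_eq => /=; ring.
Qed.

Lemma loc_mul1 : left_id (frac 1 denom1) loc_mul.
Proof.
move=> x; have [a [s ->]] := frac_surj x.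
by rewrite loc_mulE; apply: frac_eq => /=; ring.
Qed.

Lemma loc_mulDl : left_distributive loc_mul loc_add.
Proof.
move=> x y z; have [[[a [s ->]] [b [t ->]]] [c [r ->]]] :=
  (frac_surj x, frac_surj y, frac_surj z).
by rewrite !(loc_addE, loc_mulE); apply: frac_eq => /=; ring.
Qed.

HB.instance Definition _ := GRing.Zmodule_isComPzRing.Build loc
  loc_mulA loc_mulC loc_mul1 loc_mulDl.

Definition loc_of (a : R) : loc := frac a denom1.

Lemma loc_of_is_zmod_morphism : zmod_morphism loc_of.
Proof.
move=> a b; rewrite -[RHS]/(loc_add _ (loc_opp _)) loc_oppE loc_addE.
by apply: frac_eq => /=; ring.
Qed.

Lemma loc_of_is_monoid_morphism : monoid_morphism loc_of.
Proof.
split=> // a b; rewrite -[RHS]/(loc_mul _ _) loc_mulE.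
by apply: frac_eq => /=; ring.
Qed.

HB.instance Definition _ :=
  GRing.isZmodMorphism.Build R loc loc_of loc_of_is_zmod_morphism.
HB.instance Definition _ :=
  GRing.isMonoidMorphism.Build R loc loc_of loc_of_is_monoid_morphism.

End Loc.

Section TotalQuotient.
Context (R : comPzRingType).

(* [GRing.lreg r] states that multiplication by [r] is injective. *)
Definition regular_elements : mulset R :=
  Mulset (@GRing.lreg1 R) (@GRing.lregM R).

Definition total_quot : comPzRingType := loc regular_elements.

End TotalQuotient.

(** * Tensor products *)

Section Tensor.
Context (R : comPzRingType) (M N : lmodType R).

(* The tensor product of [M] and [N] is built as the set of finite formal sums
   of pairs modulo the congruence making pairs bilinear and balanced. Formal
   sums only form a monoid, so [(0, n) = 0] has to be imposed; opposites are
   then given by [- (m, n) = (- m, n)]. *)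
Inductive tens_rel : seq (M * N) -> seq (M * N) -> Prop :=
| tens_refl s : tens_rel s s
| tens_sym s t : tens_rel s t -> tens_rel t s
| tens_trans s t u : tens_rel s t -> tens_rel t u -> tens_rel s u
| tens_cat s s' t t' :
    tens_rel s s' -> tens_rel t t' -> tens_rel (s ++ t) (s' ++ t')
| tens_catC s t : tens_rel (s ++ t) (t ++ s)
| tens_addl m m' n : tens_rel [:: (m + m', n)] [:: (m, n); (m', n)]
| tens_addr m n n' : tens_rel [:: (m, n + n')] [:: (m, n); (m, n')]
| tens_bal (a : R) m n : tens_rel [:: (a *: m, n)] [:: (m, a *: n)]
| tens_0l n : tens_rel [:: (0, n)] [::].

Definition tens_eq (s t : seq (M * N)) : bool := `[< tens_rel s t >].

Lemma tens_eq_equiv : equiv_class_of tens_eq.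
Proof.
split=> [s|s t|t s u].
- by apply/asboolP; apply: tens_refl.
- by apply/idP/idP => /asboolP st; apply/asboolP; apply: tens_sym.
by move=> /asboolP st /asboolP tu; apply/asboolP; apply: tens_trans tu.
Qed.

Canonical tens_equiv := EquivRelPack tens_eq_equiv.
Canonical tens_encModRel := defaultEncModRel tens_eq.

Definition tensor : Type := {eq_quot tens_eq}.

HB.instance Definition _ := Choice.on tensor.
HB.instance Definition _ := EqQuotient.on tensor.

Definition tens_pi (s : seq (M * N)) : tensor := \pi_tensor s.

Lemma tens_piP s t : tens_pi s = tens_pi t <-> tens_rel s t.
Proof.
by split=> [/eqP|E]; [|apply/eqP]; rewrite ?piE; [move/asboolP|apply/asboolP].
Qed.

Lemma tens_piK (x : tensor) : tens_pi (repr x) = x.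
Proof. exact: reprK. Qed.

Definition tens_opp_seq (s : seq (M * N)) := [seq (- p.1, p.2) | p <- s].
Definition tens_scale_seq (a : R) (s : seq (M * N)) :=
  [seq (a *: p.1, p.2) | p <- s].

Lemma tens_scale_rel a s t :
  tens_rel s t -> tens_rel (tens_scale_seq a s) (tens_scale_seq a t).
Proof.
elim=> [{}s|{}s {}t _|{}s {}t u _ + _|{}s s' {}t t' _ + _|{}s {}t
       |m m' n|m n n'|b m n|n].
- exact: tens_refl.
- exact: tens_sym.
- exact: tens_trans.
- by rewrite /tens_scale_seq !map_cat; apply: tens_cat.
- by rewrite /tens_scale_seq !map_cat; apply: tens_catC.
- by rewrite /= scalerDr; apply: tens_addl.
- exact: tens_addr.
- by rewrite /= scalerA mulrC -scalerA; apply: tens_bal.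
- by rewrite /= scaler0; apply: tens_0l.
Qed.

Lemma tens_oppl s : tens_rel (tens_opp_seq s ++ s) [::].
Proof.
elim: s => [|[m n] s IHs] /=; first exact: tens_refl.
have mn0 : tens_rel [:: (- m, n); (m, n)] [::].
  apply: tens_trans (tens_0l n); rewrite -(addNr m).
  exact/tens_sym/tens_addl.
apply: tens_trans (tens_cat mn0 IHs).
rewrite -[_ :: _]/([:: (- m, n)] ++ _) -[[:: _; _]]/([:: (- m, n)] ++ [:: (m, n)]).
rewrite -!catA; apply: tens_cat; first exact: tens_refl.
rewrite -[_ :: s]/([:: (m, n)] ++ s) !catA.
by apply: tens_cat; [apply: tens_catC | apply: tens_refl].
Qed.

Definition tens_add (x y : tensor) : tensor := tens_pi (repr x ++ repr y).
Definition tens_opp (x : tensor) : tensor := tens_pi (tens_opp_seq (repr x)).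
Definition tens_scale (a : R) (x : tensor) : tensor :=
  tens_pi (tens_scale_seq a (repr x)).

Lemma tens_addE s t : tens_add (tens_pi s) (tens_pi t) = tens_pi (s ++ t).
Proof. by apply/tens_piP/tens_cat; apply/tens_piP; rewrite tens_piK. Qed.

Lemma tens_scaleE a s : tens_scale a (tens_pi s) = tens_pi (tens_scale_seq a s).
Proof. by apply/tens_piP/tens_scale_rel/tens_piP; rewrite tens_piK. Qed.

Lemma tens_addA : associative tens_add.
Proof.
move=> x y z; rewrite -[x]tens_piK -[y]tens_piK -[z]tens_piK.
by rewrite !tens_addE catA.
Qed.

Lemma tens_addC : commutative tens_add.
Proof.
move=> x y; rewrite -[x]tens_piK -[y]tens_piK !tens_addE.
exact/tens_piP/tens_catC.
Qed.

Lemma tens_add0 : left_id (tens_pi [::]) tens_add.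
Proof. by move=> x; rewrite -[x]tens_piK tens_addE. Qed.

Lemma tens_addN : left_inverse (tens_pi [::]) tens_opp tens_add.
Proof.
move=> x; have := tens_addE (tens_opp_seq (repr x)) (repr x).
rewrite tens_piK => ->.
exact/tens_piP/tens_oppl.
Qed.

HB.instance Definition _ :=
  GRing.isZmodule.Build tensor tens_addA tens_addC tens_add0 tens_addN.

Lemma tens_piD s t : tens_pi (s ++ t) = tens_pi s + tens_pi t.
Proof. by rewrite -tens_addE. Qed.

Lemma tens_pi_cons p s : tens_pi (p :: s) = tens_pi [:: p] + tens_pi s.
Proof. by rewrite -tens_piD. Qed.

Lemma tens_scaleA a b x :
  tens_scale a (tens_scale b x) = tens_scale (a * b) x.
Proof.
rewrite -[x]tens_piK !tens_scaleE; congr tens_pi.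
by rewrite /tens_scale_seq -map_comp; apply: eq_map => p /=; rewrite scalerA.
Qed.

Lemma tens_scale1 : left_id 1 tens_scale.
Proof.
move=> x; rewrite -[x]tens_piK !tens_scaleE; congr tens_pi.
by rewrite -[RHS]map_id; apply: eq_map => -[m n] /=; rewrite scale1r.
Qed.

Lemma tens_scaleDr : right_distributive tens_scale +%R.
Proof.
move=> a x y; rewrite -[x]tens_piK -[y]tens_piK -tens_piD !tens_scaleE.
by rewrite -tens_piD /tens_scale_seq map_cat.
Qed.

Lemma tens_scaleDl x : {morph tens_scale^~ x : a b / a + b}.
Proof.
move=> a b; rewrite -[x]tens_piK !tens_scaleE.
elim: (repr x) => [|[m n] s IHs] /=; first by rewrite addr0.
rewrite tens_pi_cons IHs scalerDl (tens_pi_cons (a *: m, n)).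
rewrite (tens_pi_cons (b *: m, n)) addrACA; congr (_ + _).
by rewrite -tens_pi_cons; apply/tens_piP/tens_addl.
Qed.

HB.instance Definition _ := GRing.Zmodule_isLmodule.Build R tensor
  tens_scaleA tens_scale1 tens_scaleDr tens_scaleDl.

Definition tens (m : M) (n : N) : tensor := tens_pi [:: (m, n)].

(* Bilinear maps factor through the tensor product. *)
Lemma tens_rel_bilinear (T : lmodType R) (b : M -> N -> T) s t :
  (forall n, linear (b^~ n)) -> (forall m, linear (b m)) ->
  tens_rel s t -> \sum_(p <- s) b p.1 p.2 = \sum_(p <- t) b p.1 p.2.
Proof.
move=> bl br; elim=> [//|{}s {}t _ ->//|{}s {}t u _ -> _ ->//
  |{}s s' {}t t' _ IHs _ IHt|{}s {}t|m m' n|m n n'|a m n|n].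
- by rewrite !big_cat IHs IHt.
- by rewrite !big_cat /= addrC.
- by rewrite !big_cons !big_nil !addr0 -[m]scale1r bl !scale1r.
- by rewrite !big_cons !big_nil !addr0 -[n]scale1r br !scale1r.
- rewrite !big_cons !big_nil !addr0 /=.
  have b0l : b 0 n = 0 by have /eqP := bl n 1 0 0;
    rewrite !scale1r addr0 -subr_eq subrr => /eqP.
  have b0r : b m 0 = 0 by have /eqP := br m 1 0 0;
    rewrite !scale1r addr0 -subr_eq subrr => /eqP.
  by rewrite -[a *: m]addr0 bl b0l -[a *: n]addr0 br b0r.
rewrite big_cons !big_nil addr0 /=; have /eqP := bl n 1 0 0.
by rewrite !scale1r addr0 -subr_eq subrr => /eqP.
Qed.

End Tensor.

Arguments tensor {R} M N.

Section TensorMap.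
Context (R : comPzRingType) (M N N' : lmodType R) (f : {linear N -> N'}).

Definition tens_map_seq (s : seq (M * N)) : seq (M * N') :=
  [seq (p.1, f p.2) | p <- s].

(* The map [id (x) f]. *)
Definition tensor_map (x : tensor M N) : tensor M N' :=
  tens_pi (tens_map_seq (repr x)).

Lemma tens_map_rel s t :
  tens_rel s t -> tens_rel (tens_map_seq s) (tens_map_seq t).
Proof.
elim=> [{}s|{}s {}t _|{}s {}t u _ + _|{}s s' {}t t' _ + _|{}s {}t
       |m m' n|m n n'|b m n|n].
- exact: tens_refl.
- exact: tens_sym.
- exact: tens_trans.
- by rewrite /tens_map_seq !map_cat; apply: tens_cat.
- by rewrite /tens_map_seq !map_cat; apply: tens_catC.
- exact: tens_addl.
- by rewrite /= linearD; apply: tens_addr.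
- by rewrite /= linearZ; apply: tens_bal.
- exact: tens_0l.
Qed.

Lemma tensor_mapE s : tensor_map (tens_pi s) = tens_pi (tens_map_seq s).
Proof. by apply/tens_piP/tens_map_rel/tens_piP; rewrite tens_piK. Qed.

Lemma tensor_map_tens m n : tensor_map (tens m n) = tens m (f n).
Proof. exact: tensor_mapE. Qed.

Lemma tensor_map_is_linear : linear tensor_map.
Proof.
move=> a x y; rewrite -[x]tens_piK -[y]tens_piK.
rewrite -[a *: _]/(tens_scale _ _) tens_scaleE -tens_piD !tensor_mapE.
rewrite /tens_map_seq map_cat tens_piD -[a *: _]/(tens_scale _ _) tens_scaleE.
by rewrite /tens_scale_seq -!map_comp.
Qed.

HB.instance Definition _ := GRing.isLinear.Build R (tensor M N) (tensor M N')
  _ tensor_map tensor_map_is_linear.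

End TensorMap.

Arguments tensor_map {R} M {N N'} f.

(** * Modules *)

Section Modules.
Context (R : comPzRingType).
Implicit Types (M N E P : lmodType R).

Definition submod_le M (A B : submod M) := forall x, A x -> B x.

Lemma submod_ext M (A B : submod M) :
  submod_le A B -> submod_le B A -> A = B.
Proof.
case: A B => [A A0 AD AZ] [B B0 BD BZ] /= AB BA.
have E : A = B.
  by apply: funext => x; apply: propext; split; [apply: AB|apply: BA].
by case: _ / E in B0 BD BZ AB BA *; congr Submod; apply: Prop_irrelevance.
Qed.

Definition uniserial M :=
  forall A B : submod M, submod_le A B \/ submod_le B A.

Definition finitely_generated M (A : submod M) :=
  exists n (v : 'I_n -> M),
    forall x, A x <-> exists c : 'I_n -> R, x = \sum_i c i *: v i.

Section Kernel.
Context (M N : lmodType R) (f : {linear M -> N}).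

Lemma ker0 : f 0 = 0. Proof. exact: linear0. Qed.
Lemma kerD x y : f x = 0 -> f y = 0 -> f (x + y) = 0.
Proof. by move=> fx fy; rewrite linearD fx fy addr0. Qed.
Lemma kerZ (a : R) x : f x = 0 -> f (a *: x) = 0.
Proof. by move=> fx; rewrite linearZ /= fx scaler0. Qed.

Definition ker : submod M := @Submod R M (fun x => f x = 0) ker0 kerD kerZ.

End Kernel.

Definition finitely_presented M :=
  exists n (f : {linear 'rV[R]_n -> M}),
    (forall y, exists x, f x = y) /\ finitely_generated (ker f).

Definition projective P :=
  forall M N (g : {linear M -> N}) (f : {linear P -> N}),
    (forall y, exists x, g x = y) ->
    exists h : {linear P -> M}, forall x, g (h x) = f x.

Definition injective_module E :=
  forall M N (i : {linear M -> N}) (f : {linear M -> E}),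
    injective i ->
    exists h : {linear N -> E}, forall x, h (i x) = f x.

Definition flat M :=
  forall N N' (i : {linear N -> N'}), injective i -> injective (tensor_map M i).

End Modules.

(** * Prime ideals *)

Record spec (R : comPzRingType) := Spec {
  spec_ideal :> ideal R;
  spec_proper : ~ spec_ideal 1;
  spec_prime : forall x y : R,
    spec_ideal (x * y) -> spec_ideal x \/ spec_ideal y
}.

Section Primes.
Context (R : comPzRingType).
Implicit Types (P Q : spec R) (I J : ideal R).

Lemma spec_ext P Q : submod_le P Q -> submod_le Q P -> P = Q.
Proof.
case: P Q => [P P1 PM] [Q Q1 QM] /= PQ QP.
have E := submod_ext PQ QP.
by case: _ / E in Q1 QM PQ QP *; congr Spec; apply: Prop_irrelevance.
Qed.

Lemma spec_compl1 P : ~ P 1. Proof. exact: (@spec_proper R P). Qed.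
Lemma spec_complM P x y : ~ P x -> ~ P y -> ~ P (x * y).
Proof. by move=> Px Py /spec_prime[]. Qed.

Definition spec_compl P : mulset R :=
  @Mulset R (fun x => ~ P x) (@spec_compl1 P) (@spec_complM P).

Definition loc_at P : comPzRingType := loc (spec_compl P).

Definition maximal I :=
  ~ I 1 /\ forall J, submod_le I J -> ~ J 1 -> submod_le J I.

Definition minimal_prime P := forall Q, submod_le Q P -> submod_le P Q.

Definition prime_chain n :=
  exists L : nat -> spec R, forall k, (k < n)%N ->
    submod_le (L k) (L k.+1) /\ ~ submod_le (L k.+1) (L k).

Definition krull_dim n :=
  prime_chain n /\ forall m, prime_chain m -> (m <= n)%N.

Definition spec_sim P Q :=
  exists n (L : nat -> spec R),
    [/\ L 0%N = P, L n = Q & forall k, (k < n)%N ->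
      submod_le (L k) (L k.+1) \/ submod_le (L k.+1) (L k)].

End Primes.

(* A point of pSpec R is an equivalence class of prime ideals. *)
Record pspec (R : comPzRingType) := Pspec {
  pspec_set :> spec R -> Prop;
  pspec_class : exists P, forall Q, pspec_set Q <-> spec_sim P Q
}.

Section PspecIdeal.
Context (R : comPzRingType) (x : pspec R).

Let A (a : R^o) :=
  forall P : spec R, x P -> loc_of (spec_compl P) (a : R) = 0.

Lemma pspec_ideal0 : A 0.
Proof. by move=> P _; rewrite rmorph0. Qed.

Lemma pspec_idealD a b : A a -> A b -> A (a + b).
Proof. by move=> Aa Ab P xP; rewrite rmorphD /= Aa ?Ab ?addr0. Qed.

Lemma pspec_idealZ (c : R) a : A a -> A (c *: a).
Proof. by move=> Aa P xP; rewrite rmorphM /= Aa ?mulr0. Qed.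

(* The ideal [A(x)]: the intersection of the kernels of [R -> R_P], [P] in [x];
   if [x] is closed in pSpec R, this is the unique pure ideal [A] such that
   [x = V(A)]. *)
Definition pspec_ideal : ideal R := Submod pspec_ideal0 pspec_idealD pspec_idealZ.

End PspecIdeal.

(** * Classes of rings *)

Section Rings.
Context (R : comPzRingType).

Definition idempotent (e : R) := e * e = e.

Definition clean := forall x : R,
  exists e u, [/\ x = e + u, idempotent e & exists v : R, u * v = 1].

Definition almost_clean := forall x : R,
  exists e r, [/\ x = e + r, idempotent e & GRing.lreg r].

Definition domain := (1 : R) <> 0 /\ GRing.integral_domain_axiom R.

Definition local_ring := exists L : ideal R,
  maximal L /\ forall L' : ideal R, maximal L' -> L' = L.

Definition valuation_ring := uniserial (R^o : lmodType R).

Definition semihereditary := forall I : ideal R,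
  finitely_generated I -> projective (submod_type I).

Definition coherent := forall I : ideal R,
  finitely_generated I -> finitely_presented (submod_type I).

Definition IF_ring := forall E : lmodType R, injective_module E -> flat E.

End Rings.

Definition arithmetical (R : comPzRingType) :=
  forall L : spec R, maximal L -> valuation_ring (loc_at L).

Definition torch_ring (R : comPzRingType) :=
  [/\ arithmetical R,
      exists L L' : ideal R, [/\ maximal L, maximal L' & L <> L']
    & exists N : spec R,
        [/\ minimal_prime N, forall N' : spec R, minimal_prime N' -> N' = N,
            exists2 a, N a & a <> 0
          & uniserial (submod_type N)]].

Definition finitely_fractionally_IF (R : comPzRingType) :=
  forall A : ideal R, finitely_generated A -> IF_ring (total_quot (ring_quot A)).

(* Main.v *)
From HB Require Import structures.
From mathcomp Require Import all_boot all_algebra.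
From mathcomp Require Import generic_quotient ring_quotient ring zify.
From mathcomp Require Import boolp classical_sets.
Require Import Defs.

(** A ring has all its injective modules flat exactly when every finitely
    presented module embeds in a free module ([fp_embed_in_free]). One direction
    ([double_annihilator_IF]) combines the equational criterion for flatness with
    the extension property of injective modules; the other
    ([IF_fp_embed_in_free]) tests flatness on the injective modules of characters
    with values in Q/Z. Over an arithmetical ring a finite family is locally
    generated by one of its members, so the condition has only to be checked on
    single elements [a]: the annihilator of [a] is finitely generated, and
    whatever it kills is a multiple of [a].

    For the total quotient ring of [R / A] the first part is coherence. The second
    asks, whenever [(A : a)] is contained in [(A : c)], for some [s] that is
    regular modulo [A] and such that [s c] lies in [R a + A]. Since [R] is coherent
    it suffices to find [s] in each Pierce stalk, that is, in each quotient of [R]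
    by the idempotents of a prime ([multiplier_near], [multiplier_global]). In an
    arithmetical ring the multipliers of [c] into [R a + A] and the annihilator of
    [A] are always comaximal ([multiplier_or_annihilator]); when moreover the
    nilradical is prime and its elements vanish away from the primes contained in
    a single prime [L], this produces [s] ([concentrated_multiplier]).

    It remains to see that the stalks have this shape. Domains, local rings and
    torch rings do. If [R] is almost clean, the stalk at [P] is [R / A(x)] for the
    class [x] of [P], because two comaximal primes made of zero divisors would
    contradict almost cleanness ([almost_clean_sim], [pspec_ideal_pierce]). If [R] is clean or of
    dimension zero its stalks are local; if [R] is semihereditary or a domain they
    are domains.

    Conversely, assume that the quotients by certain finitely generated ideals are
    their own total quotient rings, as is the case in dimension zero and, for
    nonzero ideals, in a domain of dimension one. Applying the embedding property
    modulo [x y] shows that the intersection [B] of [R x] and [R y] is finitely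
    generated; modulo [B] the same property splits the unit element into one factor
    that sends [x] into [R y] and one that sends [y] into [R x], which is the
    arithmetical property. *)

Set Implicit Arguments.
Unset Strict Implicit.
Unset Printing Implicit Defensive.

Import GRing.Theory Num.Theory.

Local Open Scope ring_scope.

(** * Prime ideals *)

Definition principal (R : comPzRingType) (a x : R) : Prop :=
  exists r, x = r * a.

Lemma idealD (R : comPzRingType) (I : ideal R) (x y : R) :
  I x -> I y -> I (x + y).
Proof. exact: submodD. Qed.

Lemma idealM (R : comPzRingType) (I : ideal R) (a x : R) :
  I x -> I (a * x).
Proof. exact: (@submodZ R R^o I a x). Qed.

Lemma idealMr (R : comPzRingType) (I : ideal R) (a x : R) :
  I x -> I (x * a).
Proof. by move=> Ix; rewrite mulrC; apply: idealM. Qed.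

Lemma ideal0 (R : comPzRingType) (I : ideal R) : I (0 : R).
Proof. exact: submod0. Qed.

Lemma idealN (R : comPzRingType) (I : ideal R) (x : R) : I x -> I (- x).
Proof. by move=> Ix; rewrite -mulN1r; apply: idealM. Qed.

Lemma ideal_sum (R : comPzRingType) (I : ideal R) (J : finType) (f : J -> R) :
  (forall j, I (f j)) -> I (\sum_j f j).
Proof.
move=> If; elim/big_rec: _ => [|j x _ Ix]; first exact: ideal0.
exact: idealD.
Qed.

Definition mk_ideal (R : comPzRingType) (A : R -> Prop) (A0 : A 0)
    (AD : forall x y, A x -> A y -> A (x + y))
    (AZ : forall a x, A x -> A (a * x)) : ideal R :=
  @Submod R R^o A A0 AD AZ.

Lemma ideal_addP (R : comPzRingType) (I J : ideal R) : exists K : ideal R,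
  forall x : R, K x <-> exists i j, [/\ I i, J j & x = i + j].
Proof.
unshelve eexists (@mk_ideal R
    (fun x => exists i j, [/\ I i, J j & x = i + j]) _ _ _) => //.
- by exists 0, 0; split; rewrite ?addr0 //; apply: ideal0.
- move=> x y [i [j [Ii Jj ->]]] [k [l [Ik Jl ->]]].
  exists (i + k), (j + l); split; try exact: idealD.
  by rewrite addrACA.
- move=> a x [i [j [Ii Jj ->]]]; exists (a * i), (a * j).
  by split; try exact: idealM; rewrite mulrDr.
Qed.

Lemma ideal_principalP (R : comPzRingType) (a : R) : exists K : ideal R,
  forall x : R, K x <-> principal a x.
Proof.
unshelve eexists (@mk_ideal R (principal a) _ _ _) => //.
- by exists 0; rewrite mul0r.
- by move=> x y [r ->] [s ->]; exists (r + s); rewrite mulrDl.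
- by move=> b x [r ->]; exists (b * r); rewrite mulrA.
Qed.

Lemma zero_idealP (R : comPzRingType) :
  exists K : ideal R, forall x : R, K x <-> x = 0.
Proof.
have [K KE] := ideal_principalP (0 : R); exists K => x; rewrite KE.
by split=> [[r ->]|->]; [exact: mulr0 | exists 0; rewrite mul0r].
Qed.

Lemma annihilator_idealP (R : comPzRingType) (a : R) :
  exists K : ideal R, forall u : R, K u <-> u * a = 0.
Proof.
unshelve eexists (@mk_ideal R (fun u => u * a = 0) _ _ _) => //.
- by rewrite /= mul0r.
- by move=> x y /= xa ya; rewrite mulrDl xa ya addr0.
- by move=> b x /= xa; rewrite -mulrA xa mulr0.
Qed.

Lemma spec_subr1 (R : comPzRingType) (P : spec R) (x : R) :
  P x -> ~ P (1 - x).
Proof.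
move=> Px P1x; apply: (@spec_proper _ P); rewrite -[1](subrK x).
exact: idealD.
Qed.

Lemma spec_prime_exp (R : comPzRingType) (P : spec R) (x : R) k :
  P (x ^+ k) -> P x.
Proof.
elim: k => [|k IHk]; first by rewrite expr0 => /spec_proper.
by rewrite exprS => /spec_prime[].
Qed.

Definition trivial_mulset (R : comPzRingType) : mulset R.
Proof.
apply: (@Mulset R (fun x => x = 1)) => // s t -> ->.
by rewrite mul1r.
Defined.

(** Krull's lemma. Maximality among the ideals avoiding [S] is recorded because
    with [S = {1}] it is what makes the prime ideal maximal. *)
Lemma prime_avoiding (R : comPzRingType) (I : ideal R) (S : mulset R) :
  (forall x : R, I x -> ~ S x) ->
  exists P : spec R, [/\ submod_le I P, forall x : R, P x -> ~ S x
    & forall J : ideal R, submod_le P J -> (forall x : R, J x -> ~ S x) ->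
        submod_le J P].
Proof.
move=> IS.
(* Joining I to X makes the empty chain harmless. *)
pose good (X : set R) := exists J : ideal R,
  [/\ forall x : R, J x <-> X x \/ I x & forall x : R, J x -> ~ S x].
have [F Fgood Ftot|X [[J [JX JS]] Xmax]] := @Zorn_bigcup R good.
  have chain x y : (I x \/ exists2 X, F X & X x) ->
      (I y \/ exists2 X, F X & X y) ->
      (I x /\ I y) \/ exists X, [/\ F X, X x \/ I x & X y \/ I y].
    move=> [Ix|[X FX Xx]] [Iy|[Y FY Yy]]; first by left.
    - by right; exists Y; split; [|right|left].
    - by right; exists X; split; [|left|right].
    - right; have [XY|YX] := Ftot X Y FX FY.
        by exists Y; split=> //; left=> //; apply: XY.
      by exists X; split=> //; left=> //; apply: YX.
  unshelve eexists (@mk_ideal R (fun x => I x \/ exists2 X, F X & X x) _ _ _).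
  - by left; apply: ideal0.
  - move=> x y Hx Hy; have [[Ix Iy]|[X [FX Xx Xy]]] := chain x y Hx Hy.
      by left; apply: idealD.
    have [J [JX _]] := Fgood X FX.
    have : J (x + y) by apply: idealD; apply/JX.
    by case/JX; [right; exists X | left].
  - move=> a x [Ix|[X FX Xx]]; first by left; apply: idealM.
    have [J [JX _]] := Fgood X FX.
    have : J (a * x) by apply: idealM; apply/JX; left.
    by case/JX; [right; exists X | left].
  split=> x /=; first by split=> [[|[X FX Xx]]|[[X FX Xx]|]];
    [right|left; exists X|right; exists X|left].
  case=> [/IS//|[X FX Xx]]; have [J [JX JS]] := Fgood X FX.
  by apply: JS; apply/JX; left.
have Jmax (K : ideal R) :
    submod_le J K -> (forall x : R, K x -> ~ S x) -> submod_le K J.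
  move=> JK KS x Kx; apply: contrapT => nJx.
  apply: (Xmax (fun y => K y)).
    split=> [y Xy|/(_ x Kx) Xx]; first by apply: JK; apply/JX; left.
    by apply: nJx; apply/JX; left.
  exists K; split=> // y; split; first by left.
  by case=> // Iy; apply: JK; apply/JX; right.
have escape (x : R) : ~ J x -> exists s j r, [/\ S s, J j & s = j + r * x].
  move=> nJx; apply: contrapT => noS.
  have [K1 K1E] := ideal_principalP x; have [K KE] := ideal_addP J K1.
  apply: nJx; apply: (Jmax K).
  - move=> y Jy; apply/KE; exists y, 0; split=> //; last by rewrite addr0.
    exact: ideal0.
  - move=> y /KE[j [k [Jj /K1E[r ->] E]]] Sy.
    by apply: noS; exists y, j, r.
  - apply/KE; exists 0, x; split; [exact: ideal0 | | by rewrite add0r].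
    by apply/K1E; exists 1; rewrite mul1r.
have J1 : ~ J 1 by move=> /JS; apply; apply: mulset1.
unshelve eexists (@Spec R J J1 _).
- move=> x y Jxy; apply: contrapT => /not_orP[/escape[s [j [r [Ss Jj Es]]]]].
  case/escape=> [t [k [q [St Jk Et]]]].
  apply: (JS (s * t)); last exact: mulsetM.
  rewrite Es Et mulrDl; apply: idealD; first exact: idealMr.
  rewrite mulrDr; apply: idealD; first by apply: idealM.
  by rewrite mulrACA; apply: idealM.
- by split=> // x Ix; apply/JX; right.
Qed.

Lemma maximal_containing (R : comPzRingType) (I : ideal R) :
  ~ I 1 -> exists2 P : spec R, submod_le I P & maximal P.
Proof.
move=> I1; have [x Ix Ex|P [IP _ Pmax]] := @prime_avoiding R I (trivial_mulset R).
  by apply: I1; rewrite -[1]Ex.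
exists P => //; split; first exact: spec_proper.
by move=> J PJ J1; apply: Pmax => // x Jx /= Ex; apply: J1; rewrite -Ex.
Qed.

Lemma ideal_all (R : comPzRingType) (I : ideal R) :
  (forall P : spec R, maximal P -> ~ submod_le I P) -> I 1.
Proof.
move=> HI; apply: contrapT => /maximal_containing[P IP Pmax].
exact: HI IP.
Qed.
(** * Arithmetical rings *)

(** The equational form of the arithmetical property: on the open sets where
    [s], respectively [1 - s], is invertible, one of [a], [b] divides the other.
    Unlike the definition by localizations, it passes to quotients and to rings
    of fractions at once. *)
Definition bezout_locally (R : comPzRingType) := forall a b : R,
  exists s, principal b (s * a) /\ principal a ((1 - s) * b).

Lemma colon_idealP (R : comPzRingType) (I : ideal R) (a : R) :
  exists K : ideal R, forall x : R, K x <-> I (x * a).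
Proof.
unshelve eexists (@mk_ideal R (fun x => I (x * a)) _ _ _) => //.
- by rewrite /= mul0r; apply: ideal0.
- by move=> x y /= Ix Iy; rewrite mulrDl; apply: idealD.
- by move=> b x /= Ix; rewrite -mulrA; apply: idealM.
Qed.

Lemma arithmetical_bezout_locally (R : comPzRingType) :
  arithmetical R -> bezout_locally R.
Proof.
move=> arR a b.
have [Ia IaE] := ideal_principalP a; have [Ib IbE] := ideal_principalP b.
have [J JE] := colon_idealP Ib a; have [K KE] := colon_idealP Ia b.
have [T TE] := ideal_addP J K.
suff : T 1.
  case/TE=> s [t [/JE/IbE bs /KE/IaE at_ E]]; exists s; split=> //.
  by have -> : 1 - s = t by rewrite E addrC addKr.
apply: ideal_all => P Pmax TP.
have divides (x y : R) : (forall u, ~ P u -> ~ principal y (u * x)) ->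
    forall r : loc_at P, loc_of (spec_compl P) x <> r * loc_of (spec_compl P) y.
  move=> nxy r; have [c [s ->]] := frac_surj r.
  rewrite -[RHS]/(loc_mul _ _) loc_mulE => /fracP[u /= Pu].
  rewrite !mulr1 => E; apply: (nxy (u * sval s)).
    by apply: spec_complM => //; apply: (denomP s).
  by exists (u * c); rewrite -!mulrA [sval s * x]mulrC E.
have V : valuation_ring (loc_at P) := arR P Pmax.
have [Va VaE] := ideal_principalP (loc_of (spec_compl P) a).
have [Vb VbE] := ideal_principalP (loc_of (spec_compl P) b).
have self (x : loc_at P) : principal x x by exists 1; rewrite mul1r.
have [ab|ba] := V Va Vb.
- have /VbE[r] := ab _ (proj2 (VaE _) (self _)); apply: divides => u Pu bu.
  apply: Pu; apply: TP; apply/TE; exists u, 0.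
  by split; [apply/JE/IbE | apply: ideal0 | rewrite addr0].
- have /VaE[r] := ba _ (proj2 (VbE _) (self _)); apply: divides => u Pu bu.
  apply: Pu; apply: TP; apply/TE; exists 0, u.
  by split; [apply: ideal0 | apply/KE/IaE | rewrite add0r].
Qed.

Lemma frac_principal (R : comPzRingType) (S : mulset R) (a b u c : R)
    (s t : denom S) :
  S u -> u * a = c * b -> principal (frac b t) (frac a s).
Proof.
move=> Su E; exists (frac (c * sval t) (denomM (mk_denom Su) s)).
rewrite -[RHS]/(loc_mul _ _) loc_mulE; apply: frac_eq => /=.
transitivity (sval s * sval t * (u * a)); first by ring.
by rewrite E; ring.
Qed.

Lemma bezout_locally_arithmetical (R : comPzRingType) :
  bezout_locally R -> arithmetical R.
Proof.
move=> bR P Pmax A B; apply: contrapT => /not_orP[nAB nBA].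
have [x Ax nBx] : exists2 x, A x & ~ B x.
  by apply: contrapT => nx; apply: nAB => x Ax; apply: contrapT => nBx;
    apply: nx; exists x.
have [y By nAy] : exists2 y, B y & ~ A y.
  by apply: contrapT => ny; apply: nBA => y By; apply: contrapT => nAy;
    apply: ny; exists y.
have [[a [s Ex]] [b [t Ey]]] := (frac_surj x, frac_surj y).
have [u [[c Ec] [d Ed]]] := bR a b.
have [Pu|Pu] := EM (P u).
- have [r E] : principal x y.
    rewrite Ex Ey; apply: (@frac_principal R (spec_compl P) _ _ (1 - u) d) Ed.
    exact: spec_subr1.
  by apply: nAy; rewrite E; apply: idealM.
- have [r E] : principal y x.
    by rewrite Ex Ey; apply: (@frac_principal R (spec_compl P) _ _ u c) Ec.
  by apply: nBx; rewrite E; apply: idealM.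
Qed.

Lemma bezout_locally_surj (R S : comPzRingType) (f : {rmorphism R -> S}) :
  (forall y, exists x, f x = y) -> bezout_locally R -> bezout_locally S.
Proof.
move=> fsurj bR a' b'; have [[a <-] [b <-]] := (fsurj a', fsurj b').
have [s [[c Ec] [d Ed]]] := bR a b.
exists (f s); split; first by exists (f c); rewrite -!rmorphM Ec.
by exists (f d); rewrite -(rmorph1 f) -rmorphB -!rmorphM Ed.
Qed.

Lemma bezout_locally_loc (R : comPzRingType) (S : mulset R) :
  bezout_locally R -> bezout_locally (loc S).
Proof.
move=> bR x y; have [[a [s ->]] [b [t ->]]] := (frac_surj x, frac_surj y).
have [u [[c Ec] [d Ed]]] := bR a b.
exists (loc_of S u); split.
- rewrite -[_ * _]/(loc_mul _ _) loc_mulE.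
  by apply: (frac_principal (u := 1) (c := c)); [exact: mulset1|rewrite mul1r].
- rewrite -(rmorph1 (loc_of S)) -rmorphB -[_ * _]/(loc_mul _ _) loc_mulE.
  by apply: (frac_principal (u := 1) (c := d)); [exact: mulset1|rewrite mul1r].
Qed.

(** A finite family is, locally on the partition of unity [s], generated by one
    of its members. Induction: refine each [s k] by comparing [a k] with the new
    member. *)
Lemma bezout_locally_partition (R : comPzRingType) (I : eqType) (a : I -> R)
    (l : seq I) :
  bezout_locally R -> uniq l -> l != [::] ->
  exists s : I -> R, \sum_(k <- l) s k = 1 /\
    forall k i, k \in l -> i \in l -> principal (a k) (s k * a i).
Proof.
move=> bR; elim: l => // j l IHl /= /andP[jl ul] _.
have [l0|ln0] := eqVneq l [::].
  exists (fun=> 1); split; first by rewrite l0 big_seq1.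
  move=> k i; rewrite l0 !inE => /eqP-> /eqP->; exists 1; by [].
have [s [s1 sP]] := IHl ul ln0.
have [p pP] := choice (fun k => bR (a k) (a j)).
pose q k := if k == j then \sum_(k <- l) s k * p k else s k * (1 - p k).
have ql k : k \in l -> q k = s k * (1 - p k).
  by rewrite /q; case: eqP => // ->; rewrite (negPf jl).
have qj : q j = \sum_(k <- l) s k * p k by rewrite /q eqxx.
have principal_sum (x : R) (f : I -> R) :
    (forall k, k \in l -> principal x (f k)) -> principal x (\sum_(k <- l) f k).
  move=> fP; have [K KE] := ideal_principalP x; apply/KE; rewrite big_seq.
  elim/big_rec: _ => [|i y il Ky]; first exact: ideal0.
  by apply: idealD => //; apply/KE/fP.
exists q; split.
  rewrite big_cons qj -s1 -big_split /= big_seq [RHS]big_seq.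
  by apply: eq_bigr => k /ql->; rewrite -mulrDr addrC subrK mulr1.
move=> k i; rewrite !inE => /predU1P[->|kl] /predU1P[->|il].
- by exists (q j).
- rewrite qj mulr_suml; apply: principal_sum => m ml.
  have [r Er] := sP m i ml il; have [[c Ec] _] := pP m.
  by exists (r * c); rewrite -[RHS]mulrA -Ec mulrCA -Er; ring.
- rewrite ql //; have [_ [d Ed]] := pP k.
  by exists (s k * d); rewrite -!mulrA Ed.
- rewrite ql //; have [r Er] := sP k i kl il.
  by exists ((1 - p k) * r); rewrite -[RHS]mulrA -Er; ring.
Qed.
(** * Coherence and the double annihilator condition *)

(** Index types are arbitrary finite types so that families can be joined by
    taking sums of their index types. *)
Definition syzygies_fg (R : comPzRingType) :=
  forall (I : finType) (a : I -> R),
  exists (J : finType) (b : J -> I -> R),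
    (forall j, \sum_i b j i * a i = 0) /\
    forall c : I -> R, \sum_i c i * a i = 0 ->
      exists d : J -> R, forall i, c i = \sum_j d j * b j i.

(** This says that the cokernel of the matrix [a] embeds, through the matrix [b],
    in a finitely generated free module. It characterizes the rings all of whose
    injective modules are flat. *)
Definition fp_embed_in_free (R : comPzRingType) :=
  forall (I H : finType) (a : I -> H -> R),
  exists (J : finType) (b : J -> I -> R),
    (forall j h, \sum_i b j i * a i h = 0) /\
    forall v : I -> R, (forall j, \sum_i b j i * v i = 0) ->
      exists r : H -> R, forall i, v i = \sum_h r h * a i h.

(** The same for the cokernel of a single column. *)
Definition double_annihilator (R : comPzRingType) :=
  forall (I : finType) (a : I -> R),
  exists (J : finType) (b : J -> I -> R),
    (forall j, \sum_i b j i * a i = 0) /\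
    forall v : I -> R, (forall j, \sum_i b j i * v i = 0) ->
      exists r, forall i, v i = r * a i.

Lemma fp_embed_in_free_column (R : comPzRingType) :
  fp_embed_in_free R -> double_annihilator R.
Proof.
move=> sR I a; have [J [b [ba bv]]] := sR I 'I_1 (fun i _ => a i).
exists J, b; split=> [j|v /bv[r vr]]; first exact: (ba j ord0).
by exists (r ord0) => i; rewrite vr big_ord1.
Qed.

(** Let [b] present the double annihilator of [a], and [C] that of [b]. Every
    column of [C] is orthogonal to the rows of [b], hence a multiple of [a], so a
    syzygy of [a] is orthogonal to [C], hence a combination of the rows
    of [b]. *)
Lemma fp_embed_in_free_syzygies (R : comPzRingType) :
  fp_embed_in_free R -> syzygies_fg R.
Proof.
move=> sR I a; have [J [b [ba bv]]] := fp_embed_in_free_column sR a.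
exists J, b; split=> // c ca.
have [K [C [Cb Cv]]] := sR I J (fun i j => b j i).
apply: Cv => k; have [|r Cr] := bv (C k).
  by move=> j; rewrite -[RHS](Cb k j); apply: eq_bigr => i _; rewrite mulrC.
transitivity (r * \sum_i c i * a i); last by rewrite ca mulr0.
by rewrite mulr_sumr; apply: eq_bigr => i _; rewrite Cr; ring.
Qed.

Lemma sum_enum_val (V : nmodType) (J : finType) (F : J -> V) :
  \sum_(k < #|J|) F (enum_val k) = \sum_j F j.
Proof. by rewrite -(big_enum_val (A := J)). Qed.

Lemma sum_delta (R : comPzRingType) (I : finType) (F : I -> R) i :
  \sum_j (j == i)%:R * F j = F i.
Proof.
rewrite (bigD1 i) //= eqxx mul1r big1 ?addr0 // => j /negPf->.
by rewrite mul0r.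
Qed.

Lemma finitely_generated_fin (R : comPzRingType) (M : lmodType R)
    (A : submod M) (J : finType) (v : J -> M) :
  (forall x, A x <-> exists c : J -> R, x = \sum_j c j *: v j) ->
  finitely_generated A.
Proof.
move=> AE; exists #|J|, (fun k => v (enum_val k)) => x; split.
- case/AE=> c ->; exists (fun k => c (enum_val k)).
  by rewrite (sum_enum_val (fun j => c j *: v j)).
- case=> c ->; apply/AE; exists (fun j => c (enum_rank j)).
  rewrite -[RHS]sum_enum_val; apply: eq_bigr => k _.
  by rewrite enum_valK.
Qed.

Lemma combination_idealP (R : comPzRingType) (I : finType) (a : I -> R) :
  exists K : ideal R,
    forall x : R, K x <-> exists c : I -> R, x = \sum_i c i * a i.
Proof.
unshelve eexists (@mk_ideal R
  (fun x => exists c : I -> R, x = \sum_i c i * a i) _ _ _) => //.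
- by exists (fun=> 0); rewrite big1 // => i _; rewrite mul0r.
- move=> x y [c ->] [d ->]; exists (fun i => c i + d i).
  by rewrite -big_split; apply: eq_bigr => i _; rewrite mulrDl.
- move=> b x [c ->]; exists (fun i => b * c i).
  by rewrite mulr_sumr; apply: eq_bigr => i _; rewrite mulrA.
Qed.

Lemma mem_combination (R : comPzRingType) (I : finType) (a : I -> R) i :
  exists c : I -> R, a i = \sum_j c j * a j.
Proof. by exists (fun j => (j == i)%:R); rewrite sum_delta. Qed.

Lemma submod_elt (R : comPzRingType) (M : lmodType R) (N : submod M) (x : M) :
  N x -> {y : submod_type N | \val y = x}.
Proof. by move=> /submod_predP Nx; exists (SubmodElt Nx). Qed.

Lemma rowE (R : comPzRingType) n (r : 'rV[R]_n) :
  r = \sum_j r 0 j *: delta_mx 0 j.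
Proof. exact: row_sum_delta. Qed.

(** Two presentations of an ideal differ by a change of generators [W], [U]; the
    syzygies of [a] are generated by the images under [W] of those of the given
    presentation, together with the rows of [1 - U W]. *)
Lemma coherent_syzygies (R : comPzRingType) : coherent R -> syzygies_fg R.
Proof.
move=> cR I a; have [K KE] := combination_idealP a.
have fgK : finitely_generated K.
  exact: (@finitely_generated_fin R R^o K I a KE).
have [n [f [fsurj [m [u kerE]]]]] := cR K fgK.
have [A AE] : {A : I -> submod_type K | forall i, \val (A i) = a i}.
  have Ka i : K (a i) by apply/KE/mem_combination.
  by exists (fun i => sval (submod_elt (Ka i))) => i;
    apply: (svalP (submod_elt (Ka i))).
have [U UE] := choice (fun i => fsurj (A i)).
have WP j : exists w : I -> R, \val (f (delta_mx 0 j)) = \sum_i w i * a i.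
  by apply/KE; apply/submod_predP; apply: valP.
have [W WE] := choice WP.
have valf (r : 'rV_n) : \val (f r) = \sum_i (\sum_j r 0 j * W j i) * a i :> R.
  rewrite [in LHS](rowE r) linear_sum raddf_sum /=.
  under eq_bigr => j _ do rewrite linearZ /= WE.
  under [RHS]eq_bigr => i _ do rewrite mulr_suml.
  rewrite exchange_big; apply: eq_bigr => j _.
  by rewrite [LHS]mulr_sumr; apply: eq_bigr => i _; rewrite mulrA.
pose b (j : 'I_m + I) i' := match j with
  | inl k => \sum_j u k 0 j * W j i'
  | inr i => (i == i')%:R - \sum_j U i 0 j * W j i' end.
exists ('I_m + I)%type, b; split.
  case=> [k|i] /=.
  - rewrite -valf; have -> : f (u k) = 0; last by [].
    apply/(kerE (u k)); exists (fun j => (j == k)%:R).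
    rewrite (bigD1 k) //= eqxx scale1r big1 ?addr0 // => j /negPf->.
    by rewrite scale0r.
  - under eq_bigr => i' _ do rewrite mulrBl eq_sym.
    rewrite big_split /= sum_delta sumrN -valf UE AE; exact: subrr.
move=> c ca.
have /(kerE _)[e Ee] : f (\sum_i c i *: U i) = 0.
  apply: val_inj; rewrite linear_sum raddf_sum /= -[RHS]ca.
  by apply: eq_bigr => i _; rewrite linearZ /= UE AE.
exists (fun j => match j with inl k => e k | inr i => c i end) => i'.
rewrite big_sumType /=.
have -> : \sum_k e k * (\sum_j u k 0 j * W j i')
    = \sum_j (\sum_k e k *: u k) 0 j * W j i'.
  under [RHS]eq_bigr => j _ do rewrite summxE mulr_suml.
  rewrite exchange_big; apply: eq_bigr => k _; rewrite mulr_sumr.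
  by apply: eq_bigr => j _; rewrite mxE mulrA.
rewrite -Ee; under [X in _ + X]eq_bigr => i _ do rewrite mulrBr mulrC.
rewrite big_split /= sum_delta sumrN.
have -> : \sum_j (\sum_i c i *: U i) 0 j * W j i'
    = \sum_i c i * (\sum_j U i 0 j * W j i').
  under eq_bigr => j _ do rewrite summxE mulr_suml.
  rewrite exchange_big; apply: eq_bigr => k _; rewrite mulr_sumr.
  by apply: eq_bigr => j _; rewrite mxE mulrA.
by rewrite addrCA subrr addr0.
Qed.

Lemma syzygies_coherent (R : comPzRingType) : syzygies_fg R -> coherent R.
Proof.
move=> sR I [n [v IE]].
have Iv i : I (v i).
  apply/IE; exists (fun j => (j == i)%:R).
  rewrite (bigD1 i) //= eqxx scale1r big1 ?addr0 // => j /negPf->.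
  by rewrite scale0r.
pose V i := sval (submod_elt (Iv i)).
have VE i : \val (V i) = v i := svalP (submod_elt (Iv i)).
pose f (r : 'rV[R]_n) : submod_type I := \sum_i r 0 i *: V i.
have flin : linear f.
  move=> c x y; rewrite /f scaler_sumr -big_split; apply: eq_bigr => i _.
  by rewrite !mxE scalerDl scalerA.
pose F : {linear 'rV[R]_n -> submod_type I} :=
  HB.pack f (GRing.isLinear.Build R _ _ _ f flin).
have valF r : \val (F r) = \sum_i r 0 i * v i :> R.
  have -> : F r = \sum_i r 0 i *: V i by [].
  by rewrite raddf_sum /=; apply: eq_bigr => i _; rewrite VE.
have [J [b [bv bc]]] := sR 'I_n v.
exists n, F; split.
  move=> y; have /submod_predP/IE[c Ec] := valP y.
  exists (\row_i c i); apply: val_inj; rewrite valF Ec.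
  by apply: eq_bigr => i _; rewrite mxE.
apply: (finitely_generated_fin (v := fun j => \row_i b j i)) => x; split.
- move=> /(congr1 \val); rewrite valF => /bc[d Ed].
  exists d; apply/rowP => i; rewrite Ed summxE; apply: eq_bigr => j _.
  by rewrite !mxE.
- case=> d ->; apply: val_inj; rewrite valF.
  under eq_bigr => i _ do rewrite summxE mulr_suml.
  rewrite exchange_big big1 // => j _.
  transitivity (d j * \sum_i b j i * v i); last by rewrite bv mulr0.
  by rewrite mulr_sumr; apply: eq_bigr => i _; rewrite !mxE mulrA.
Qed.
Lemma bezout_locally_family (R : comPzRingType) (I : finType) (a : I -> R) :
  bezout_locally R -> I ->
  exists (s : I -> R) (t : I -> I -> R), \sum_k s k = 1 /\
    forall k i, s k * a i = t k i * a k.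
Proof.
move=> bR i0; have [|s [s1 sP]] := bezout_locally_partition a bR (enum_uniq I).
  by apply/eqP => E; have := mem_enum I i0; rewrite E.
have tP k : exists t : I -> R, forall i, s k * a i = t i * a k.
  have sPk i : principal (a k) (s k * a i) by apply: sP; rewrite mem_enum.
  by have [t tE] := choice sPk; exists t.
have [t tE] := choice tP.
by exists s, t; split=> //; rewrite -[RHS]s1 big_enum.
Qed.

(** Equivalently, the principal ideals are projective. *)
Definition principal_projective (R : comPzRingType) := forall a : R,
  exists e, [/\ e * e = e, e * a = 0 & forall r, r * a = 0 -> r = r * e].

(** Where [s k] is invertible, the syzygies of [a] are generated by the relations
    [s k * a i = t k i * a k] and by the annihilator of [a k]. *)
Lemma principal_projective_syzygies (R : comPzRingType) :
  bezout_locally R -> principal_projective R -> syzygies_fg R.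
Proof.
move=> bR ppR I a; have [i0|I0] := pselect (inhabited I); last first.
  exists I, (fun _ _ => 0); split=> [j|c _]; first by case: I0.
  by exists (fun=> 0) => i; case: I0.
case: i0 => i0; have [s [t [s1 st]]] := bezout_locally_family a bR i0.
have [e eP] := choice (fun k => ppR (a k)).
pose b (j : I * I + I) i' := match j with
  | inl (k, i) => s k * (i' == i)%:R - t k i * (i' == k)%:R
  | inr k => e k * (i' == k)%:R end.
have sumd (x : R) (F : I -> R) i : \sum_i' x * (i' == i)%:R * F i' = x * F i.
  rewrite -[in RHS](sum_delta F) mulr_sumr.
  by apply: eq_bigr => i' _; rewrite mulrA.
exists (I * I + I)%type, b; split.
  case=> [[k i]|k] /=.
    under eq_bigr => i' _ do rewrite mulrBl.
    by rewrite sumrB !sumd st subrr.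
  by rewrite sumd; case: (eP k).
move=> c ca; pose z k := \sum_i c i * t k i.
have ze k : z k = z k * e k.
  case: (eP k) => _ _; apply; rewrite mulr_suml.
  transitivity (s k * \sum_i c i * a i); last by rewrite ca mulr0.
  rewrite mulr_sumr; apply: eq_bigr => i _.
  by rewrite -mulrA -st mulrCA.
exists (fun j => match j with inl (_, i) => c i | inr k => z k end) => i'.
rewrite big_sumType /=.
rewrite [X in _ = X + _](_ : _ = c i' - \sum_k z k * (i' == k)%:R); last first.
  transitivity
      (\sum_k \sum_i c i * (s k * (i' == i)%:R - t k i * (i' == k)%:R)).
    by rewrite pair_bigA; apply: eq_bigr => -[k i] _.
  have -> : c i' = \sum_k s k * c i' by rewrite -mulr_suml s1 mul1r.
  rewrite -sumrB; apply: eq_bigr => k _.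
  rewrite mulr_suml -(sum_delta c) mulr_sumr -sumrB.
  by apply: eq_bigr => i _; rewrite [i == i']eq_sym; ring.
under [X in _ + X]eq_bigr => k _ do rewrite mulrA -ze.
by rewrite subrK.
Qed.

(** Again the relations [s k * a i = t k i * a k] reduce the condition on a column
    to the condition on single elements. *)
Lemma double_annihilator_elements (R : comPzRingType) :
  bezout_locally R ->
  (forall a : R, exists (J : finType) (b : J -> R), (forall j, b j * a = 0) /\
    forall v, (forall j, b j * v = 0) -> principal a v) ->
  double_annihilator R.
Proof.
move=> bR dR I a; have [i0|I0] := pselect (inhabited I); last first.
  exists I, (fun _ _ => 0); split=> [j|c _]; first by case: I0.
  by exists 0 => i; case: I0.
case: i0 => i0; have [s [t [s1 st]]] := bezout_locally_family a bR i0.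
have BP k : exists B : {J : finType & J -> R},
    (forall j, projT2 B j * a k = 0) /\
    forall v, (forall j, projT2 B j * v = 0) -> principal (a k) v.
  by have [J [b bP]] := dR (a k); exists (existT _ J b).
have [B BE] := choice BP.
pose b (j : I * I + {k : I & projT1 (B k)}) i' := match j with
  | inl (k, i) => s k * (i' == i)%:R - t k i * (i' == k)%:R
  | inr p => projT2 (B (tag p)) (tagged p) * (i' == tag p)%:R end.
have sumd (x : R) (F : I -> R) i : \sum_i' x * (i' == i)%:R * F i' = x * F i.
  rewrite -[in RHS](sum_delta F) mulr_sumr.
  by apply: eq_bigr => i' _; rewrite mulrA.
have sumB x y i k (F : I -> R) :
    \sum_i' (x * (i' == i)%:R - y * (i' == k)%:R) * F i' = x * F i - y * F k.
  under eq_bigr => i' _ do rewrite mulrBl.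
  by rewrite sumrB !sumd.
exists _, b; split.
  case=> [[k i]|[k j]] /=; first by rewrite sumB st subrr.
  by rewrite sumd; case: (BE k).
move=> v vb.
have rP k : principal (a k) (v k).
  case: (BE k) => _; apply => j; rewrite -sumd.
  exact: (vb (inr (existT _ k j))).
have [r rE] := choice rP.
have tv k i : s k * v i = t k i * v k.
  by apply/subr0_eq; rewrite -sumB; apply: (vb (inl (k, i))).
exists (\sum_k s k * r k) => i.
rewrite -[LHS]mul1r -s1 !mulr_suml; apply: eq_bigr => k _.
by rewrite tv rE mulrCA -st; ring.
Qed.

(** * Flatness and systems of linear equations *)

(** Every linear relation between elements of [M] is a consequence of relations
    between scalars. *)
Definition equational_criterion (R : comPzRingType) (M : lmodType R) :=
  forall (J : finType) (a : J -> R) (y : J -> M), \sum_j a j *: y j = 0 ->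
  exists (K : finType) (b : J -> K -> R) (z : K -> M),
    (forall j, y j = \sum_k b j k *: z k) /\ forall k, \sum_j a j * b j k = 0.

(** Writing each left factor of [s] as a combination of the [y j] transforms the
    formal sum [s] into the sum of the [y j (x) g j]. *)
Fixpoint expands (R : comPzRingType) (M N : lmodType R) (J : finType)
    (y : J -> M) (s : seq (M * N)) (g : J -> N) : Prop :=
  if s is p :: s' then exists (a : J -> R) (g' : J -> N),
    [/\ p.1 = \sum_j a j *: y j, expands y s' g'
      & forall j, g j = a j *: p.2 + g' j]
  else forall j, g j = 0.

Definition vanishes (R : comPzRingType) (M N : lmodType R) (s : seq (M * N)) :=
  exists (J : finType) (y : J -> M) (g : J -> N),
    expands y s g /\ forall j, g j = 0.

Lemma expands_ext (R : comPzRingType) (M N : lmodType R) (J : finType)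
    (y : J -> M) (s : seq (M * N)) (g h : J -> N) :
  expands y s g -> g =1 h -> expands y s h.
Proof. by move=> sg /funext <-. Qed.

Lemma expands_cat (R : comPzRingType) (M N : lmodType R) (J : finType)
    (y : J -> M) (s t : seq (M * N)) (g : J -> N) :
  expands y (s ++ t) g <-> exists g1 g2,
    [/\ expands y s g1, expands y t g2 & forall j, g j = g1 j + g2 j].
Proof.
elim: s g => [|p s IHs] g /=; split.
- by move=> tg; exists (fun=> 0), g; split=> // j; rewrite add0r.
- by case=> g1 [g2 [g10 tg2 E]]; apply: expands_ext tg2 _ => j;
    rewrite E g10 add0r.
- case=> a [g' [Ep /IHs[g1 [g2 [sg1 tg2 E']]] E]].
  exists (fun j => a j *: p.2 + g1 j), g2; split=> //; first by exists a, g1.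
  by move=> j; rewrite E E' addrA.
- case=> g1 [g2 [[a [g' [Ep sg' E1]]] tg2 E]].
  exists a, (fun j => g' j + g2 j); split=> // [|j].
    by apply/IHs; exists g', g2.
  by rewrite E E1 addrA.
Qed.

Lemma sum_scale_comm (R : comPzRingType) (M : lmodType R) (J K : finType)
    (a : J -> R) (b : J -> K -> R) (z : K -> M) :
  \sum_j a j *: (\sum_k b j k *: z k) = \sum_k (\sum_j a j * b j k) *: z k.
Proof.
under eq_bigr => j _ do rewrite scaler_sumr.
rewrite exchange_big; apply: eq_bigr => k _; rewrite scaler_suml.
by apply: eq_bigr => j _; rewrite scalerA.
Qed.

Lemma expands_change (R : comPzRingType) (M N : lmodType R) (J K : finType)
    (y : J -> M) (z : K -> M) (b : J -> K -> R) (s : seq (M * N))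
    (g : J -> N) :
  (forall j, y j = \sum_k b j k *: z k) -> expands y s g ->
  expands z s (fun k => \sum_j b j k *: g j).
Proof.
move=> yE; elim: s g => [|p s IHs] g /=.
  by move=> g0 k; rewrite big1 // => j _; rewrite g0 scaler0.
case=> a [g' [Ep /IHs sg' E]].
exists (fun k => \sum_j a j * b j k), (fun k => \sum_j b j k *: g' j).
split=> // [|k].
  rewrite Ep; under eq_bigr => j _ do rewrite yE.
  exact: sum_scale_comm.
rewrite scaler_suml -big_split; apply: eq_bigr => j _.
by rewrite E scalerDr scalerA mulrC.
Qed.

Lemma expands_map (R : comPzRingType) (M N N' : lmodType R)
    (f : {linear N -> N'}) (J : finType) (y : J -> M) (s : seq (M * N))
    (h : J -> N') :
  expands y (tens_map_seq f s) h ->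
  exists2 g, expands y s g & forall j, h j = f (g j).
Proof.
elim: s h => [|p s IHs] h /=.
  by move=> h0; exists (fun=> 0) => // j; rewrite h0 linear0.
case=> a [h' [Ep /IHs[g' sg' E'] E]].
exists (fun j => a j *: p.2 + g' j); first by exists a, g'.
by move=> j; rewrite E E' linearD linearZ.
Qed.

Lemma tens0l (R : comPzRingType) (M N : lmodType R) n :
  tens 0 n = 0 :> tensor M N.
Proof. exact/tens_piP/tens_0l. Qed.

Lemma tens0r (R : comPzRingType) (M N : lmodType R) m :
  tens m 0 = 0 :> tensor M N.
Proof.
rewrite -[0 in LHS](scale0r 0) -[RHS](tens0l _ 0) -[0 in RHS](scale0r m).
by apply/tens_piP/tens_sym/tens_bal.
Qed.

Lemma tens_suml (R : comPzRingType) (M N : lmodType R) (J : finType)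
    (a : J -> R) (y : J -> M) n :
  tens (\sum_j a j *: y j) n = \sum_j tens (y j) (a j *: n) :> tensor M N.
Proof.
elim/big_ind2: _ => [|x X x' X' <- <-|j _]; first exact: tens0l.
  by rewrite -[RHS]tens_piD; apply/tens_piP/tens_addl.
exact/tens_piP/tens_bal.
Qed.

Lemma tens_sumr (R : comPzRingType) (M N : lmodType R) (J : finType)
    m (g : J -> N) :
  tens m (\sum_j g j) = \sum_j tens m (g j) :> tensor M N.
Proof.
elim/big_ind2: _ => [|x X x' X' <- <-|//]; first exact: tens0r.
by rewrite -[RHS]tens_piD; apply/tens_piP/tens_addr.
Qed.

Lemma tens_pi_sum (R : comPzRingType) (M N : lmodType R) (s : seq (M * N)) :
  tens_pi s = \sum_(p <- s) tens p.1 p.2.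
Proof.
elim: s => [|[m n] s IHs]; first by rewrite big_nil.
by rewrite tens_pi_cons big_cons IHs.
Qed.

Lemma expands_tens (R : comPzRingType) (M N : lmodType R) (J : finType)
    (y : J -> M) (s : seq (M * N)) (g : J -> N) :
  expands y s g -> tens_pi s = \sum_j tens (y j) (g j).
Proof.
elim: s g => [|[m n] s IHs] g /=.
  by move=> g0; rewrite big1 // => j _; rewrite g0 tens0r.
case=> a [g' [/= -> /IHs sg' E]].
rewrite tens_pi_cons sg' -[tens_pi [:: _]]/(tens _ _) tens_suml -big_split.
apply: eq_bigr => j _; rewrite E -[LHS]tens_piD.
exact/tens_piP/tens_sym/tens_addr.
Qed.

(** Related formal sums may replace each other inside a sum that vanishes. The
    equational criterion is what allows a left factor that is written in two
    ways to be treated as one. *)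
Lemma tens_rel_vanishes (R : comPzRingType) (M N : lmodType R)
    (s t : seq (M * N)) :
  equational_criterion M -> tens_rel s t ->
  forall w, vanishes (s ++ w) <-> vanishes (t ++ w).
Proof.
move=> eqM.
have swap (s1 s2 w : seq (M * N)) :
    vanishes (s1 ++ s2 ++ w) -> vanishes (s2 ++ s1 ++ w).
  case=> J [y [g [/expands_cat[g1 [g2 [e1 e2w E]]] g0]]].
  have [g3 [g4 [e2 ew E2]]] := proj1 (expands_cat _ _ _ _) e2w.
  exists J, y, g; split=> //; apply/expands_cat.
  exists g3, (fun j => g1 j + g4 j).
  split=> // [|j]; last by rewrite E E2 addrCA.
  by apply/expands_cat; exists g1, g4.
(* The common form of the uses of the criterion: a relation between the y j can
   be removed by passing to a new family. *)
have relate (J : finType) (y : J -> M) (w : seq (M * N)) (g : J -> N)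
    (a : J -> R) : expands y w g -> \sum_j a j *: y j = 0 ->
    exists (K : finType) (b : J -> K -> R) (z : K -> M),
    [/\ forall j, y j = \sum_k b j k *: z k, forall k, \sum_j a j * b j k = 0
      & expands z w (fun k => \sum_j b j k *: g j)].
  move=> yw /eqM[K [b [z [yE ab]]]]; exists K, b, z; split=> //.
  exact: expands_change yw.
have adjoin (J : finType) (y : J -> M) (m : M) (w : seq (M * N)) (g : J -> N) :
    expands y w g ->
    expands (fun k : 'I_1 + J => match k with inl _ => m | inr j => y j end) w
      (fun k => match k with inl _ => 0 | inr j => g j end).
  move=> yw; pose b (j : J) (k : 'I_1 + J) : R := (k == inr j)%:R.
  apply: (expands_ext (expands_change (b := b) _ yw)).
    move=> j; rewrite (bigD1 (inr j)) //= /b eqxx scale1r big1 ?addr0 // => k.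
    by move=> /negPf->; rewrite scale0r.
  case=> [i|j]; first by rewrite big1 // => j _; rewrite /b /= scale0r.
  rewrite (bigD1 j) //= /b eqxx scale1r big1 ?addr0 // => k /negPf kj.
  by rewrite (inj_eq inr_inj) eq_sym kj scale0r.
elim=> {s t} [//|s t _ IH w|s t u _ IHs _ IHt w|s s' t t' _ IHs _ IHt w
  |s t w|m m' n w|m n n' w|c m n w|n w].
- by rewrite IH.
- by rewrite IHs IHt.
- by rewrite -!catA IHs; split=> /swap/IHt/swap.
- by rewrite -!catA; split; apply: swap.
- split=> [[J [y [g [[a [g' [/= Em yw E]]] g0]]]]|].
    pose d (k : 'I_1 + J) : R := if k is inl _ then 1 else 0.
    pose d' (k : 'I_1 + J) : R := if k is inr j then a j else -1.
    exists _, (fun k : 'I_1 + J => match k with inl _ => m | inr j => y j end).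
    exists (fun=> 0); split=> //; exists d, (fun k => - (d k *: n)).
    split=> [||k]; last by rewrite addrN.
      rewrite big_sumType big_ord1 /= scale1r [X in _ + X]big1 ?addr0 // => j _.
      exact: scale0r.
    exists d'; eexists; split; [|exact: (adjoin _ _ m _ _ yw)|].
      by rewrite big_sumType big_ord1 /= scaleN1r -Em addrA addNr add0r.
    case=> [i|j] /=; first by rewrite scale1r scaleN1r addr0.
    by rewrite scale0r oppr0 -(g0 j) E.
  case=> J [y [g [[a [g1 [/= Em [a' [g' [/= Em' yw E']] E]]]] g0]]].
  exists J, y, g; split=> //; exists (fun j => a j + a' j), g'; split=> //= [|j].
    by rewrite Em Em' -big_split; apply: eq_bigr => j _; rewrite scalerDl.
  by rewrite E E' scalerDl addrA.
- split=> [[J [y [g [[a [g' [/= Em yw E]]] g0]]]]|].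
    exists J, y, g; split=> //; exists a, (fun j => a j *: n' + g' j).
    split=> // [|j]; last by rewrite E scalerDr addrA.
    by exists a, g'.
  case=> J [y [g [[a [g1 [/= Em [a' [g' [/= Em' yw E']] E]]]] g0]]].
  have [|K [b [z [yE ab zw]]]] := relate J y w g' (fun j => a j - a' j) yw.
    under eq_bigr => j _ do rewrite scalerBl.
    by rewrite sumrB -Em -Em' subrr.
  eexists K, z, (fun=> 0); split=> //.
  exists (fun k => \sum_j a j * b j k); eexists; split; [|exact: zw|].
    by rewrite /= Em; under eq_bigr => j _ do rewrite yE; apply: sum_scale_comm.
  move=> k; have a'E : \sum_j a j * b j k = \sum_j a' j * b j k.
    by apply/subr0_eq; rewrite -sumrB -[RHS](ab k);
      apply: eq_bigr => j _; rewrite mulrBl.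
  rewrite /= scalerDr {2}a'E !scaler_suml -!big_split big1 // => j _ /=.
  have := g0 j; rewrite E E' => E0.
  rewrite mulrC -[a' j * _]mulrC -!scalerA -!scalerDr -addrA E0.
  by rewrite scaler0.
- split=> [[J [y [g [[a [g' [/= Em yw E]]] g0]]]]|].
    pose d (k : 'I_1 + J) : R := if k is inr j then - a j else c.
    have [|K [b [z [yE ab zw]]]] := relate _ _ _ _ d (adjoin _ _ m _ _ yw).
      rewrite big_sumType big_ord1 /= Em; under [X in _ + X]eq_bigr => j _ do
        rewrite scaleNr.
      by rewrite sumrN subrr.
    eexists K, z, (fun=> 0); split=> //.
    exists (b (inl ord0)); eexists; split; [exact: (yE (inl ord0))|exact: zw|].
    move=> k; have := ab k; rewrite !big_sumType !big_ord1 /=.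
    under eq_bigr => j _ do rewrite mulNr.
    rewrite sumrN => /subr0_eq cE.
    rewrite scaler0 add0r scalerA mulrC cE scaler_suml -big_split big1 // => j _.
    have := g0 j; rewrite E => E0.
    by rewrite /= mulrC -scalerA -scalerDr E0 scaler0.
  case=> J [y [g [[a [g' [/= Em yw E]]] g0]]].
  exists J, y, g; split=> //; exists (fun j => c * a j), g'; split=> //= [|j].
    by rewrite Em scaler_sumr; apply: eq_bigr => j _; rewrite scalerA.
  by rewrite E scalerA mulrC.
- split=> [[J [y [g [[a [g' [/= Em yw E]]] g0]]]]|].
    have [//|K [b [z [yE ab zw]]]] := relate J y w g' a yw.
    eexists K, z, _; split; first exact: zw.
    move=> k; transitivity (\sum_j (b j k *: g' j + (a j * b j k) *: n)).
      by rewrite big_split /= -scaler_suml ab scale0r addr0.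
    rewrite big1 // => j _; have := g0 j; rewrite E => E0.
    by rewrite mulrC -scalerA -scalerDr addrC E0 scaler0.
  case=> J [y [g [yw g0]]]; exists J, y, g; split=> //.
  exists (fun=> 0), g; split=> //= [|j]; last by rewrite scale0r add0r.
  by rewrite big1 // => j _; rewrite scale0r.
Qed.

Lemma equational_criterion_flat (R : comPzRingType) (M : lmodType R) :
  equational_criterion M -> flat M.
Proof.
move=> eqM N N' i iinj.
suff ker0 (x : tensor M N) : tensor_map M i x = 0 -> x = 0.
  by move=> x y E; apply/subr0_eq/ker0; rewrite linearB /= E subrr.
rewrite -[x]tens_piK tensor_mapE => /tens_piP rel.
have [_ /(_ _)[]] := tens_rel_vanishes eqM rel [::].
  exists void, (fun=> 0), (fun=> 0); split=> // j.
move=> J [y [h [+ h0]]]; rewrite cats0 => /expands_map[g sg hE].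
rewrite (expands_tens sg) big1 // => j _.
have -> : g j = 0 by apply: iinj; rewrite -hE h0 linear0.
exact: tens0r.
Qed.
(** The relations of the family [y] factor through the matrix [b], because a
    vector killed by [b] is a multiple of [a] and hence a relation of [y];
    injectivity of [E] extends this factorization from the image of [b] to the
    whole free module. *)
Lemma double_annihilator_IF (R : comPzRingType) :
  double_annihilator R -> IF_ring R.
Proof.
move=> dR E injE; apply: equational_criterion_flat => J a y ay.
have [K [b [ba bv]]] := dR J a.
pose F := {ffun K -> R^o}.
pose im (v : J -> R) : F := [ffun k => \sum_i b k i * v i].
have im_lin (c : R) v w : im (fun i => c * v i + w i) = c *: im v + im w.
  apply/ffunP => k; rewrite !ffunE [c *: _]mulr_sumr -big_split.
  by apply: eq_bigr => i _ /=; ring.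
pose comb (v : J -> R) : E := \sum_i v i *: y i.
have comb_lin (c : R) v w :
    comb (fun i => c * v i + w i) = c *: comb v + comb w.
  rewrite /comb scaler_sumr -big_split; apply: eq_bigr => i _.
  by rewrite scalerDl scalerA.
have im_comb v w : im v = im w -> comb v = comb w.
  move=> Evw; have [|r rE] := bv (fun i => v i - w i).
    move=> k; under eq_bigr => i _ do rewrite mulrBr.
    have /ffunP/(_ k) := Evw; rewrite !ffunE sumrB => ->.
    exact: subrr.
  apply/subr0_eq; rewrite -sumrB.
  transitivity (r *: \sum_i a i *: y i); last by rewrite ay scaler0.
  rewrite scaler_sumr; apply: eq_bigr => i _.
  by rewrite -scalerBl rE scalerA.
have [N NE] : exists N : submod F, forall x, N x <-> exists v, x = im v.
  have im0 : im (fun=> 0) = 0.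
    by apply/ffunP => k; rewrite !ffunE big1 // => i _; rewrite mulr0.
  unshelve eexists (@Submod R F (fun x => exists v, x = im v) _ _ _) => //.
  - by exists (fun=> 0).
  - move=> _ _ [v ->] [w ->]; exists (fun i => 1 * v i + w i).
    by rewrite im_lin scale1r.
  - move=> c _ [v ->]; exists (fun i => c * v i + 0).
    by rewrite (im_lin c v (fun=> 0)) im0 addr0.
have NP (x : submod_type N) : exists v, \val x = im v.
  by apply/NE/submod_predP; apply: valP.
have [pre preE] := choice NP.
pose f (x : submod_type N) : E := comb (pre x).
have flin : linear f.
  by move=> c x x'; rewrite /f -comb_lin; apply: im_comb;
    rewrite im_lin -!preE linearP.
pose f' : {linear submod_type N -> E} :=
  HB.pack f (GRing.isLinear.Build R _ _ _ f flin).
pose i : {linear submod_type N -> F} := val.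
have [h hE] := injE _ _ i f' val_inj.
pose delta k : F := [ffun k' => (k' == k)%:R].
exists K, (fun j k => b k j), (fun k => h (delta k)); split=> [j|k]; last first.
  by rewrite -[RHS](ba k); apply: eq_bigr => j _; rewrite mulrC.
have Nj : N (im (fun l => (l == j)%:R)) by apply/NE; eexists.
have [x xE] := submod_elt Nj.
have -> : y j = f' x.
  transitivity (comb (fun l => (l == j)%:R)).
    rewrite /comb (bigD1 j) //= eqxx scale1r big1 ?addr0 // => l /negPf->.
    by rewrite scale0r.
  by apply: im_comb; rewrite -preE.
rewrite -hE [i x]xE.
have -> : im (fun l => (l == j)%:R) = \sum_k b k j *: delta k.
  apply/ffunP => k; rewrite !ffunE sum_ffunE.
  transitivity (b k j); last first.
    rewrite (bigD1 k) //= big1 ?addr0 => [|l lk]; rewrite !ffunE.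
      by rewrite eqxx [_ *: _]mulr1.
    by rewrite eq_sym (negPf lk) scaler0.
  by under eq_bigr => l _ do rewrite mulrC; rewrite sum_delta.
rewrite linear_sum; apply: eq_bigr => k _; exact: linearZ.
Qed.
Lemma sum_scale_delta (R : comPzRingType) (M : lmodType R) (I : finType)
    (F : I -> M) i :
  \sum_j (j == i)%:R *: F j = F i.
Proof.
rewrite (bigD1 i) //= eqxx scale1r big1 ?addr0 // => j /negPf->.
by rewrite scale0r.
Qed.

(** The converse of the equational criterion, for systems: a system of relations
    of [e] says that the sum of the [e i (x) row i] vanishes in the tensor product
    with a free module, hence by flatness in that with the submodule [N]
    generated by the rows. There, [e i (x) row i] is tracked by the bilinear map
    that expresses elements of [N] through the rows, which is well defined up to
    families [w] of the desired form. *)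
Lemma flat_systems (R : comPzRingType) (E : lmodType R) (I H : finType)
    (a : I -> H -> R) (e : I -> E) :
  flat E -> (forall h, \sum_i a i h *: e i = 0) ->
  exists (J : finType) (b : J -> I -> R) (y : J -> E),
    (forall j h, \sum_i b j i * a i h = 0) /\
    forall i, e i = \sum_j b j i *: y j.
Proof.
move=> flatE ae; pose F := {ffun H -> R^o}.
pose solved (w : I -> E) := exists (J : finType) (b : J -> I -> R) (y : J -> E),
  (forall j h, \sum_i b j i * a i h = 0) /\ forall i, w i = \sum_j b j i *: y j.
have solvedD w w' : solved w -> solved w' -> solved (fun i => w i + w' i).
  case=> [J [b [y [ba wE]]]] [J' [b' [y' [ba' wE']]]].
  exists (J + J')%type, (fun k => match k with inl j => b j | inr j => b' j end).
  exists (fun k => match k with inl j => y j | inr j => y' j end).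
  by split=> [[j|j] h //|i]; rewrite big_sumType /= wE wE'.
have solvedN w : solved w -> solved (fun i => - w i).
  case=> [J [b [y [ba wE]]]]; exists J, b, (fun j => - y j); split=> // i.
  by rewrite wE -sumrN; apply: eq_bigr => j _; rewrite scalerN.
have solved0 w : (forall i, w i = 0) -> solved w.
  move=> w0; exists 'I_0, (fun _ _ => 0), (fun=> 0); split=> [[]//|i].
  by rewrite w0 big_ord0.
have solved1 (r : I -> R) m :
    (forall h, \sum_i r i * a i h = 0) -> solved (fun i => r i *: m).
  move=> ra; exists 'I_1, (fun=> r), (fun=> m); split=> // i.
  by rewrite big_ord1.
pose row i : F := [ffun h => a i h].
have rowE' (r : I -> R) h : (\sum_i r i *: row i) h = \sum_i r i * a i h.
  by rewrite sum_ffunE; apply: eq_bigr => i _; rewrite !ffunE.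
have [N NE] : exists N : submod F,
    forall x, N x <-> exists r : I -> R, x = \sum_i r i *: row i.
  unshelve eexists (@Submod R F
    (fun x => exists r : I -> R, x = \sum_i r i *: row i) _ _ _) => //.
  - by exists (fun=> 0); rewrite big1 // => i _; rewrite scale0r.
  - move=> _ _ [r ->] [s ->]; exists (fun i => r i + s i).
    by rewrite -big_split; apply: eq_bigr => i _; rewrite scalerDl.
  - move=> c _ [r ->]; exists (fun i => c * r i).
    by rewrite scaler_sumr; apply: eq_bigr => i _; rewrite scalerA.
have NP (x : submod_type N) : exists r : I -> R, \val x = \sum_i r i *: row i.
  by apply/NE/submod_predP; apply: valP.
have [lift liftE] := choice NP.
have lift_rel (x : submod_type N) (r : I -> R) : \val x = \sum_i r i *: row i ->
    forall h, \sum_i (r i - lift x i) * a i h = 0.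
  move=> xE h; under eq_bigr => i _ do rewrite mulrBl.
  by rewrite sumrB -!rowE' -xE -liftE subrr.
pose Phi (s : seq (E * submod_type N)) i := \sum_(p <- s) lift p.2 i *: p.1.
have PhiE s t : tens_rel s t -> solved (fun i => Phi s i - Phi t i).
  elim=> {s t} [s|s t _|s t u _ st _ tu|s s' t t' _ IHs _ IHt|s t
    |m m' n|m n n'|c m n|n].
  - by apply: solved0 => i; rewrite subrr.
  - by move/solvedN; congr solved; apply/funext => i; rewrite opprB.
  - have := solvedD _ _ st tu; congr solved; apply/funext => i.
    by rewrite addrA subrK.
  - have := solvedD _ _ IHs IHt; congr solved; apply/funext => i.
    by rewrite /Phi !big_cat /= opprD addrACA.
  - by apply: solved0 => i; rewrite /Phi !big_cat /= addrC subrr.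
  - apply: solved0 => i; rewrite /Phi !big_cons !big_nil /= !addr0 scalerDr.
    by rewrite subrr.
  - have E1 h : \sum_i (lift (n + n') i - (lift n i + lift n' i)) * a i h = 0.
      have := lift_rel (n + n') (fun i => lift n i + lift n' i).
      rewrite raddfD /= {1}(liftE n) {1}(liftE n') -big_split /=.
      under eq_bigr => i _ do rewrite -scalerDl.
      move=> /(_ erefl h) E1; rewrite -[RHS]oppr0 -[in RHS]E1 -sumrN.
      by apply: eq_bigr => i _; ring.
    have := solved1 _ m E1; congr solved; apply/funext => i.
    by rewrite /Phi !big_cons !big_nil /= !addr0 scalerBl scalerDl.
  - have E1 h : \sum_i (c * lift n i - lift (c *: n) i) * a i h = 0.
      apply: lift_rel; rewrite linearZ /= {1}(liftE n) scaler_sumr.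
      by apply: eq_bigr => i _; rewrite scalerA.
    have := solved1 _ m E1; congr solved; apply/funext => i.
    by rewrite /Phi !big_cons !big_nil /= !addr0 scalerA scalerBl [c * _]mulrC.
  - apply: solved0 => i; rewrite /Phi !big_cons !big_nil /= scaler0 addr0.
    by rewrite subrr.
have Nrow i : N (row i).
  by apply/NE; exists (fun j => (j == i)%:R); rewrite sum_scale_delta.
pose x i := sval (submod_elt (Nrow i)).
have xE i : \val (x i) = row i := svalP (submod_elt (Nrow i)).
pose i0 : {linear submod_type N -> F} := val.
pose s := [seq (e i, x i) | i <- index_enum I].
pose delta h : F := [ffun h' => (h' == h)%:R].
have s0 : tens_pi s = 0.
  apply: (flatE _ _ i0 val_inj); rewrite linear0 tensor_mapE tens_pi_sum.
  rewrite /tens_map_seq -map_comp big_map /=.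
  transitivity (\sum_h tens (\sum_i a i h *: e i) (delta h)); last first.
    by rewrite big1 // => h _; rewrite ae tens0l.
  under [RHS]eq_bigr => h _ do rewrite tens_suml.
  rewrite exchange_big; apply: eq_bigr => i _.
  rewrite -tens_sumr xE; congr tens; apply/ffunP => h; rewrite sum_ffunE ffunE.
  rewrite -[LHS](sum_delta (a i)); apply: eq_bigr => h' _.
  by rewrite !ffunE eq_sym mulrC.
have solved_rest : solved (fun i => e i - Phi s i).
  pose w k i := ((i == k)%:R - lift (x k) i) *: e k.
  have wE i : e i - Phi s i = \sum_k w k i.
    rewrite -[e i in LHS](sum_scale_delta e) /Phi big_map -sumrB.
    by apply: eq_bigr => k _; rewrite /w scalerBl eq_sym.
  have w_solved k : solved (w k).
    apply: solved1; apply: lift_rel.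
    by rewrite xE -[LHS](sum_scale_delta row).
  have -> : (fun i => e i - Phi s i) = (fun i => \sum_k w k i) by apply/funext.
  elim: (index_enum I) => [|k l IHl].
    by apply: solved0 => i; rewrite big_nil.
  have := solvedD _ _ (w_solved k) IHl; congr solved; apply/funext => i.
  by rewrite big_cons.
have /PhiE s_solved : tens_rel s [::] by apply/tens_piP.
have := solvedD _ _ solved_rest s_solved; congr solved; apply/funext => i.
by rewrite /Phi big_nil subr0 subrK.
Qed.
(** * Extension of additive maps *)

Lemma pi_zmodP (V : zmodType) (I : zmodClosed V) :
  exists p : V -> Quotient.quot I,
    [/\ forall x y, p x = p y <-> x - y \in I, forall y, exists x, p x = y
      & forall x y, p (x + y) = p x + p y].
Proof.
exists (fun x => \pi_(Quotient.quot I)%qT x); split.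
- by move=> x y; rewrite -Quotient.equivE; split=> [/eqP|E];
    [|apply/eqP]; rewrite piE.
- by move=> y; exists (repr y)%qT; apply: reprK.
- exact: Quotient.pi_add.
Qed.

(** The group Q/Z. *)
Lemma divisible_cogenerator : exists D : zmodType,
  (forall (d : D) k, (0 < k)%N -> exists d', d' *+ k = d) /\
  (forall k, k != 1%N -> exists2 d : D, d != 0 & d *+ k = 0).
Proof.
have [N NE] : exists N : submod (zmodule rat),
    forall x : rat, N x <-> exists z : int, x = z%:~R.
  unshelve eexists (@Submod int (zmodule rat)
    (fun x : rat => exists z : int, x = z%:~R) _ _ _) => //.
  - by exists 0.
  - by move=> _ _ [y ->] [z ->]; exists (y + z); rewrite rmorphD.
  - by move=> c _ [z ->]; exists (c * z); rewrite rmorphM /= mulrzl.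
have [p [pE psurj pD]] := pi_zmodP (submod_pred N : zmodClosed (zmodule rat)).
have p0 : p 0 = 0 by apply: (addrI (p 0)); rewrite -pD !addr0.
have pMn x k : p (x *+ k) = p x *+ k.
  by elim: k => [|k IH]; rewrite ?mulr0n // !mulrS pD IH.
have pint (x : rat) : p x = 0 <-> exists z : int, x = z%:~R.
  by rewrite -p0 pE subr0 -NE; split=> [/submod_predP|/submod_predP].
exists (Quotient.quot (submod_pred N)); split.
  move=> d k k0; have [x <-] := psurj d.
  exists (p ((x : rat) / k%:R)); rewrite -pMn; congr p.
  rewrite -[LHS]/(((x : rat) / k%:R) *+ k) -[LHS]mulr_natr divfK //.
  by rewrite pnatr_eq0 -lt0n.
have p_inv k : (1 < k)%N -> p (k%:R^-1 : rat) != 0.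
  move=> k1; have k0 : (k%:R : rat) != 0 by rewrite pnatr_eq0; lia.
  apply/eqP => /pint[z /(congr1 (fun x => x * k%:R))].
  rewrite mulVf // [X in _ = _ * X]pmulrn -intrM -[1]/(1%:~R) => /eqP.
  rewrite eqr_int => /eqP/(congr1 absz)/esym/eqP; rewrite abszM muln_eq1.
  by move=> /andP[_ /eqP kE]; move: k1; rewrite -[k]/(absz k) kE.
case=> [|[//|k]] _.
  by exists (p (2%:R^-1 : rat)); [apply: p_inv | rewrite mulr0n].
exists (p (k.+2%:R^-1 : rat)); first exact: p_inv.
rewrite -pMn; apply/pint; exists 1.
by rewrite -[LHS]/((k.+2%:R^-1 : rat) *+ k.+2) -[LHS]mulr_natr mulVf ?pnatr_eq0.
Qed.

(** The graph of an additive map defined on a subgroup. *)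
Definition partial_additive (N D : zmodType) (G : N -> D -> Prop) :=
  [/\ G 0 0, forall x d y e, G x d -> G y e -> G (x - y) (d - e)
    & forall d, G 0 d -> d = 0].

Lemma partial_additive_uniq (N D : zmodType) (G : N -> D -> Prop) x d e :
  partial_additive G -> G x d -> G x e -> d = e.
Proof.
case=> _ GB Gf Gd Ge; apply/subr0_eq/Gf.
by rewrite -[X in G X _](subrr x); apply: GB.
Qed.

Lemma partial_additiveN (N D : zmodType) (G : N -> D -> Prop) x d :
  partial_additive G -> G x d -> G (- x) (- d).
Proof.
by case=> G0 GB _ Gxd; rewrite -(sub0r x) -(sub0r d); apply: GB.
Qed.

Lemma partial_additiveD (N D : zmodType) (G : N -> D -> Prop) x d y e :
  partial_additive G -> G x d -> G y e -> G (x + y) (d + e).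
Proof.
move=> Gadd Gxd Gye; rewrite -[y]opprK -[e]opprK.
by case: (Gadd) => _ GB _; apply: GB => //; apply: partial_additiveN.
Qed.

Lemma partial_additiveMz (N D : zmodType) (G : N -> D -> Prop) x d (z : int) :
  partial_additive G -> G x d -> G (x *~ z) (d *~ z).
Proof.
move=> Gadd Gxd; have GMn n : G (x *+ n) (d *+ n).
  elim: n => [|n IH]; first by case: Gadd.
  by rewrite !mulrS; apply: partial_additiveD.
by case: z => n; [apply: GMn | apply: partial_additiveN].
Qed.

Lemma partial_additive_adjoin (N D : zmodType) (G : N -> D -> Prop) x d :
  partial_additive G ->
  (forall (z : int) e, G (x *~ z) e -> e = d *~ z) ->
  exists G', [/\ partial_additive G', forall y e, G y e -> G' y e & G' x d].
Proof.
case=> G0 GB Gf dP.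
exists (fun y e => exists z : int, G (y - x *~ z) (e - d *~ z)); split.
- split; first by exists 0; rewrite !mulr0z !subr0.
  + move=> y e y' e' [z Gz] [z' Gz']; exists (z - z').
    have swap (V : zmodType) (p q r s : V) :
        p - q - (r - s) = (p - r) - (q - s).
      by rewrite !opprB addrACA [RHS]addrACA [- r + _]addrC.
    by rewrite !mulrzBr [X in G X _]swap [X in G _ X]swap; apply: GB.
  + move=> e [z]; rewrite sub0r -mulrNz => /dP; rewrite mulrNz => /eqP.
    by rewrite subr_eq addNr => /eqP.
- by move=> y e Gy; exists 0; rewrite !mulr0z !subr0.
- by exists 1; rewrite !mulr1z !subrr.
Qed.

Lemma multiplesP (N : zmodType) (H : N -> Prop) x :
  H 0 -> (forall y z, H y -> H z -> H (y - z)) ->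
  exists k : nat, forall z : int, H (x *~ z) <-> exists q : int, z = q * k%:Z.
Proof.
move=> H0 HB.
have HN y : H y -> H (- y) by move=> Hy; rewrite -sub0r; apply: HB.
have HD y z : H y -> H z -> H (y + z).
  by move=> Hy Hz; rewrite -[z]opprK; apply: HB => //; apply: HN.
have HMz y (z : int) : H y -> H (y *~ z).
  have HMn n : H y -> H (y *+ n).
    by move=> Hy; elim: n => [|n IH]; rewrite ?mulr0n // mulrS; apply: HD.
  by case: z => n Hy; [apply: HMn | apply/HN/HMn].
have absH (z : int) : H (x *~ z) -> H (x *+ `|z|%N).
  case: (intP z) => [|n|n] //=; rewrite ?mulrNz => /HN;
    by rewrite ?opprK // => /HN; rewrite opprK.
have [[z Hz z0]|none] :=
    pselect (exists2 z : int, H (x *~ z) & z != 0); last first.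
  exists 0%N => z; split=> [Hz|[q ->]]; last by rewrite mulr0 mulr0z.
  exists 0; rewrite mul0r; apply: contrapT => /eqP z0.
  by apply: none; exists z.
pose P k := (0 < k)%N && `[< H (x *+ k) >].
have exP : exists k, P k.
  by exists `|z|%N; rewrite /P absz_gt0 z0; apply/asboolP/absH.
case: (ex_minnP exP) => k /andP[k0 /asboolP Hk] kmin; exists k => {z Hz z0} z.
split=> [Hz|[q ->]]; last by rewrite mulrC mulrzA; apply: HMz.
exists (z %/ k)%Z; rewrite {1}(divz_eq z k).
suff -> : (z %% k)%Z = 0 by rewrite addr0.
have Hr : H (x *~ (z %% k)%Z).
  rewrite /modz mulrzBr [_ * k%:Z]mulrC mulrzA; apply: HB => //; exact: HMz.
apply/eqP/negPn/negP => r0.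
have := kmin `|(z %% k)%Z|%N; rewrite /P absz_gt0 r0 /=.
have /asboolP-> := absH _ Hr; move=> /(_ isT).
have := ltz_pmod z (_ : 0 < k%:Z); have := modz_ge0 z (_ : k%:Z != 0); lia.
Qed.

Lemma additive_extension (N D : zmodType) (G : N -> D -> Prop) :
  (forall (d : D) k, (0 < k)%N -> exists d', d' *+ k = d) ->
  partial_additive G ->
  exists f : N -> D, (forall x y, f (x + y) = f x + f y) /\
    forall x d, G x d -> f x = d.
Proof.
move=> divD Gadd.
(* Joining G to X makes the empty chain harmless. *)
pose graph (X : set (N * D)) x d := X (x, d) \/ G x d.
have [F Fgood Ftot|X [Xadd Xmax]] :=
    @Zorn_bigcup (N * D) (fun X => partial_additive (graph X)).
  have chain x d y e : graph (\bigcup_(X in F) X)%classic x d ->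
      graph (\bigcup_(X in F) X)%classic y e ->
      (G x d /\ G y e) \/ exists X, [/\ F X, graph X x d & graph X y e].
    move=> [[X FX Xx]|Gx] [[Y FY Yy]|Gy]; last by left.
    - right; have [XY|YX] := Ftot X Y FX FY.
        by exists Y; split=> //; left=> //; apply: XY.
      by exists X; split=> //; left=> //; apply: YX.
    - by right; exists X; split=> //; [left|right].
    - by right; exists Y; split=> //; [right|left].
  have [G0 GB Gf] := Gadd; split; first by right.
    move=> x d y e Hx Hy; have [[Gx Gy]|[X [FX Xx Xy]]] := chain _ _ _ _ Hx Hy.
      by right; apply: GB.
    have [_ XB _] := Fgood X FX.
    by have [Xxy|Gxy] := XB _ _ _ _ Xx Xy; [left; exists X|right].
  move=> d [[X FX Xd]|/Gf//]; have [_ _ Xf] := Fgood X FX.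
  by apply: Xf; left.
have [X0 XB Xf] := Xadd.
have total x : exists d, graph X x d.
  pose H y := exists e, graph X y e.
  have [||k kP] := @multiplesP N H x; first by exists 0.
    by move=> y z [d Xy] [e Xz]; exists (d - e); apply: XB.
  have [d dP] : exists d, forall (z : int) e, graph X (x *~ z) e -> e = d *~ z.
    have [k0|k0] := posnP k.
      exists 0 => z e Xe; rewrite mul0rz; apply: Xf.
      have [q zE] : exists q : int, z = q * k%:Z by apply/kP; exists e.
      by move: Xe; rewrite zE k0 mulr0 mulr0z.
    have [e0 Xe0] : H (x *~ k) by apply/kP; exists 1; rewrite mul1r.
    have [d dE] := divD e0 k k0; exists d => z e Xe.
    have [q zE] : exists q : int, z = q * k%:Z by apply/kP; exists e.
    apply: (partial_additive_uniq Xadd Xe).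
    by rewrite zE mulrC !mulrzA (dE : d *~ k = e0); apply: partial_additiveMz.
  have [G' [G'add XG' G'x]] := partial_additive_adjoin Xadd dP.
  apply: contrapT => nox; apply: (Xmax (fun p => G' p.1 p.2)).
    split=> [[y e] Xye|]; first by apply: XG'; left.
    by move/(_ (x, d) G'x) => Xx; apply: nox; exists d; left.
  suff -> : graph (fun p => G' p.1 p.2) = G' by [].
  apply/funext => y; apply/funext => e; apply/propext.
  by split=> [[//|Gy]|]; [apply: XG'; right | left].
have [f fE] := choice total; exists f; split=> [x y|x d Gx].
  apply: (partial_additive_uniq Xadd (fE _)).
  exact: partial_additiveD.
by apply: (partial_additive_uniq Xadd (fE x)); right.
Qed.

(** A character separating [v] from [H]: its value at [v] must be killed by the
    order of [v] modulo [H]. *)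
Lemma separating_character (N D : zmodType) (H : N -> Prop) v :
  (forall (d : D) k, (0 < k)%N -> exists d', d' *+ k = d) ->
  (forall k, k != 1%N -> exists2 d : D, d != 0 & d *+ k = 0) ->
  H 0 -> (forall y z, H y -> H z -> H (y - z)) -> ~ H v ->
  exists f : N -> D, [/\ forall x y, f (x + y) = f x + f y,
    forall x, H x -> f x = 0 & f v <> 0].
Proof.
move=> divD torD H0 HB Hv; have [k kP] := multiplesP v H0 HB.
have [|d d0 dk] := torD k.
  apply/eqP => k1; apply: Hv; rewrite -[v]mulr1z; apply/kP.
  by exists 1; rewrite k1.
have Gadd : partial_additive (fun (x : N) (e : D) => H x /\ e = 0).
  split=> //; last by move=> e [].
  by move=> x d' y e' [Hx ->] [Hy ->]; split; [apply: HB | rewrite subrr].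
have [z e|G' [G'add GG' G'v]] := partial_additive_adjoin (x := v) (d := d) Gadd.
  by case=> /kP[q ->] ->; rewrite mulrC mulrzA -pmulrn dk mul0rz.
have [f [fD fE]] := additive_extension divD G'add.
exists f; split=> [//|x Hx|]; first by apply/fE/GG'.
by rewrite (fE _ _ G'v); apply/eqP.
Qed.
(** * Character modules *)

(** Families of characters of the additive group of [R], indexed by [T]: the
    coinduced module of the power [D ^ T]. *)
Record char_module (T : Type) (R : comPzRingType) (D : zmodType) := CharModule {
  char_val :> T -> R -> D;
  char_valD : forall t x y, char_val t (x + y) = char_val t x + char_val t y
}.

HB.instance Definition _ (T : Type) (R : comPzRingType) (D : zmodType) :=
  gen_eqMixin (char_module T R D).
HB.instance Definition _ (T : Type) (R : comPzRingType) (D : zmodType) :=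
  gen_choiceMixin (char_module T R D).

Section CharModuleStructure.
Context (T : Type) (R : comPzRingType) (D : zmodType).
Implicit Types (f g h : char_module T R D).

Lemma char_ext f g : (forall t r, f t r = g t r) -> f = g.
Proof.
case: f g => [f fD] [g gD] /= E.
have {}E : f = g by apply/funext => t; apply/funext => r.
by case: _ / E in gD *; congr CharModule; apply: Prop_irrelevance.
Qed.

Definition char_add f g : char_module T R D.
Proof.
exists (fun t r => f t r + g t r) => t x y.
by rewrite !char_valD addrACA.
Defined.

Definition char_opp f : char_module T R D.
Proof.
by exists (fun t r => - f t r) => t x y; rewrite char_valD opprD.
Defined.

Definition char_zero : char_module T R D.
Proof. by exists (fun _ _ => 0) => t x y; rewrite addr0. Defined.

Definition char_scale (c : R) f : char_module T R D.
Proof.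
by exists (fun t r => f t (r * c)) => t x y; rewrite mulrDl char_valD.
Defined.

Lemma char_addA : associative char_add.
Proof. by move=> f g h; apply: char_ext => t r; apply: addrA. Qed.

Lemma char_addC : commutative char_add.
Proof. by move=> f g; apply: char_ext => t r; apply: addrC. Qed.

Lemma char_add0 : left_id char_zero char_add.
Proof. by move=> f; apply: char_ext => t r; apply: add0r. Qed.

Lemma char_addN : left_inverse char_zero char_opp char_add.
Proof. by move=> f; apply: char_ext => t r; apply: addNr. Qed.

HB.instance Definition _ := GRing.isZmodule.Build (char_module T R D)
  char_addA char_addC char_add0 char_addN.

Lemma char_scaleA c d f :
  char_scale c (char_scale d f) = char_scale (c * d) f.
Proof. by apply: char_ext => t r /=; rewrite mulrA. Qed.

Lemma char_scale1 : left_id 1 char_scale.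
Proof. by move=> f; apply: char_ext => t r /=; rewrite mulr1. Qed.

Lemma char_scaleDr : right_distributive char_scale +%R.
Proof. by move=> c f g; apply: char_ext. Qed.

Lemma char_scaleDl f : {morph char_scale^~ f : c d / c + d}.
Proof. by move=> c d; apply: char_ext => t r /=; rewrite mulrDr char_valD. Qed.

HB.instance Definition _ := GRing.Zmodule_isLmodule.Build R (char_module T R D)
  char_scaleA char_scale1 char_scaleDr char_scaleDl.

Lemma char_val0 f t : f t 0 = 0.
Proof. by apply: (addrI (f t 0)); rewrite -char_valD !addr0. Qed.

Lemma char_val_sum f t (I : finType) (F : I -> R) :
  f t (\sum_i F i) = \sum_i f t (F i).
Proof. exact: (big_morph _ (char_valD f t) (char_val0 f t)). Qed.

Lemma char_sum_val (I : finType) (F : I -> char_module T R D) t r :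
  (\sum_i F i) t r = \sum_i F i t r.
Proof. exact: (big_morph (fun f => char_val f t r)). Qed.

(** An [R]-linear map to this module is a [T]-indexed family of additive maps to
    [D], namely its values at [1]. *)
Lemma char_module_injective :
  (forall (d : D) k, (0 < k)%N -> exists d', d' *+ k = d) ->
  injective_module (char_module T R D).
Proof.
move=> divD M N i f iinj.
pose G t (x : N) (d : D) := exists m, x = i m /\ d = f m t 1.
have Gadd t : partial_additive (G t).
  split; first by exists 0; rewrite !linear0.
    move=> _ _ _ _ [m [-> ->]] [m' [-> ->]]; exists (m - m').
    by rewrite !linearB.
  by move=> d [m [/esym E ->]]; have -> : m = 0; rewrite ?linear0 //;
    apply: iinj; rewrite E linear0.
have [g gP] := choice (fun t => additive_extension divD (Gadd t)).
have gD t x y : g t (x + y) = g t x + g t y by case: (gP t).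
have gi t m : g t (i m) = f m t 1 by case: (gP t) => _; apply; exists m.
have gZ n t x y : g t ((x + y) *: n) = g t (x *: n) + g t (y *: n).
  by rewrite scalerDl gD.
pose h (n : N) := @CharModule T R D (fun t r => g t (r *: n)) (gZ n).
have hlin : linear h.
  by move=> c x y; apply: char_ext => t r /=; rewrite scalerDr scalerA gD.
pose h' : {linear N -> char_module T R D} :=
  HB.pack h (GRing.isLinear.Build R _ _ _ h hlin).
exists h' => x; apply: char_ext => t r /=.
by rewrite -linearZ gi linearZ /= mul1r.
Qed.

End CharModuleStructure.

(** Let [T] be the set of all characters of the free module on [I] that kill the
    columns of [a]. The tautological family [e] in the character module over [T]
    satisfies the relations [a], so by flatness its members are combinations of
    some [y j] with coefficients [b j]. Consequently every character that kills
    the columns of [a] kills the vectors orthogonal to [b]; as characters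
    separate, those vectors are combinations of the columns of [a]. *)
Lemma IF_fp_embed_in_free (R : comPzRingType) : IF_ring R -> fp_embed_in_free R.
Proof.
move=> IFR I H a; have [D [divD torD]] := divisible_cogenerator.
pose col (r : H -> R) : {ffun I -> R} := [ffun i => \sum_h r h * a i h].
pose T := {f : {ffun I -> R} -> D |
  (forall x y, f (x + y) = f x + f y) /\ forall r, f (col r) = 0}.
pose unit_vec (r : R) i : {ffun I -> R} := [ffun j => r * (j == i)%:R].
have unit_vecD i (t : T) x y : sval t (unit_vec (x + y) i) =
    sval t (unit_vec x i) + sval t (unit_vec y i).
  have [tD _] := svalP t; rewrite -tD; congr (sval t _).
  by apply/ffunP => j; rewrite !ffunE mulrDl.
pose e i :=
  @CharModule T R D (fun t r => sval t (unit_vec r i)) (unit_vecD i).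
have sval_sum (t : T) (J : finType) (F : J -> {ffun I -> R}) :
    sval t (\sum_j F j) = \sum_j sval t (F j).
  have [tD _] := svalP t; apply: (big_morph _ tD).
  by apply: (addrI (sval t 0)); rewrite -tD !addr0.
have flatE := IFR _ (@char_module_injective T R D divD).
have [|J [b [y [ba eE]]]] := @flat_systems R _ I H a e flatE.
  move=> h; apply: char_ext => t r; rewrite char_sum_val /=.
  rewrite -sval_sum -[RHS](proj2 (svalP t) (fun h' => r * (h' == h)%:R)).
  congr (sval t _); apply/ffunP => j; rewrite sum_ffunE ffunE.
  transitivity (r * a j h).
    rewrite -[in RHS](sum_delta (fun i => a i h)) mulr_sumr.
    by apply: eq_bigr => i _; rewrite ffunE eq_sym; ring.
  rewrite -[in LHS](sum_delta (a j)) mulr_sumr.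
  by apply: eq_bigr => h' _; rewrite mulrA.
exists J, b; split=> // v vb; apply: contrapT => nv.
pose v' : {ffun I -> R} := [ffun i => v i].
have [|||f [fD fcol]] := @separating_character _ D
    (fun x => exists r, x = col r) v' divD torD.
- exists (fun=> 0); apply/ffunP => i; rewrite !ffunE big1 // => h _.
  exact: mul0r.
- move=> _ _ [r ->] [s ->]; exists (fun h => r h - s h); apply/ffunP => i.
  by rewrite !ffunE -sumrB; apply: eq_bigr => h _; rewrite mulrBl.
- by case=> r /ffunP E; apply: nv; exists r => i; have := E i; rewrite !ffunE.
have ft : (forall x y, f (x + y) = f x + f y) /\ forall r, f (col r) = 0.
  by split=> // r; apply: fcol; exists r.
apply; pose t : T := exist _ f ft.
transitivity (\sum_i e i t (v i)).
  rewrite /= -(sval_sum t) /=; congr f; apply/ffunP => i.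
  rewrite ffunE sum_ffunE -[LHS](sum_delta v).
  by apply: eq_bigr => j _; rewrite ffunE eq_sym mulrC.
transitivity (\sum_j y j t (\sum_i b j i * v i)); last first.
  by rewrite big1 // => j _; rewrite vb char_val0.
under eq_bigr => i _ do rewrite eE char_sum_val.
rewrite exchange_big; apply: eq_bigr => j _; rewrite char_val_sum.
by apply: eq_bigr => i _; rewrite mulrC.
Qed.
(** * Elements with comparable annihilators modulo an ideal *)

Definition generates (R : comPzRingType) (I : finType) (al : I -> R)
    (A : ideal R) :=
  forall x : R, A x <-> exists c : I -> R, x = \sum_i c i * al i.

Lemma generates_mem (R : comPzRingType) (I : finType) (al : I -> R)
    (A : ideal R) i : generates al A -> A (al i).
Proof. by move=> genA; apply/genA/mem_combination. Qed.

Lemma multiplier_idealP (R : comPzRingType) (A : ideal R) (a c : R) :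
  exists J : ideal R,
    forall u : R, J u <-> exists x y, u * c = x * a + y /\ A y.
Proof.
have [Ia IaE] := ideal_principalP a; have [B BE] := ideal_addP Ia A.
have [J JE] := colon_idealP B c; exists J => u; rewrite JE BE; split.
  by case=> i [y [/IaE[x ->] Ay E]]; exists x, y.
by case=> x [y [E Ay]]; exists (x * a), y; split=> //; apply/IaE; exists x.
Qed.

(** Where [A] is generated by [e = al k], write [w a = d c] and [u e = x a]. Modulo
    [J] one has [w = u = 1] and [d = 0]. Since [x c] lies in [A], it is a multiple
    [y e] of [e]; then [z x c = 0] for [z = w u s k - y d], which is
    [s k] modulo [J], and so [z w u] annihilates [e]. Thus [s k ^ 2] belongs to the
    sum of [J] and the annihilator of [A]. *)
Lemma multiplier_or_annihilator (R : comPzRingType) (I : finType)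
    (al : I -> R) (A J : ideal R) (a c : R) :
  bezout_locally R -> generates al A ->
  (forall r : R, A (r * a) -> A (r * c)) ->
  (forall u : R, J u <-> exists x y, u * c = x * a + y /\ A y) ->
  exists j n : R, [/\ J j, forall x : R, A x -> n * x = 0 & 1 = j + n].
Proof.
move=> bR genA ac JE.
have [i0|I0] := pselect (inhabited I); last first.
  exists 0, 1; split; rewrite ?add0r //; first exact: ideal0.
  by move=> x /genA[b ->]; rewrite big1 ?mulr0 // => i _; case: I0.
case: i0 => i0; have [s [t [s1 st]]] := bezout_locally_family al bR i0.
have [N NE] : exists N : ideal R,
    forall n : R, N n <-> forall x, A x -> n * x = 0.
  unshelve eexists
    (@mk_ideal R (fun n => forall x, A x -> n * x = 0) _ _ _) => //.
  - by move=> x _; rewrite mul0r.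
  - by move=> m n /= Am An x Ax; rewrite mulrDl Am ?An ?addr0.
  - by move=> b n /= An x Ax; rewrite -mulrA An ?mulr0.
have [T TE] := ideal_addP J N.
suff /TE[j [n [Jj /NE Nn E]]] : T 1 by exists j, n.
suff Ts k : T (s k * s k).
  apply: ideal_all => P _ TP; apply: (@spec_proper _ P); rewrite -s1.
  elim/big_rec: _ => [|k x _ Px]; first exact: ideal0.
  by apply: idealD => //; have [] := spec_prime (TP _ (Ts k)).
have Aal i : A (al i) by apply: generates_mem.
have sA x : A x -> principal (al k) (s k * x).
  case/genA=> b ->; exists (\sum_i b i * t k i); rewrite mulr_sumr mulr_suml.
  by apply: eq_bigr => i _; rewrite -mulrA -st mulrCA.
have [w [[d Ed] [d' Ed']]] := bR a c.
have [u [[x Ex] [x' Ex']]] := bR (al k) a.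
have Jw : J (1 - w).
  by apply/JE; exists d', 0; rewrite addr0; split=> //; apply: ideal0.
have Ju : J (1 - u).
  apply/JE; exists 0, ((1 - u) * c); rewrite mul0r add0r; split=> //.
  by apply: ac; rewrite Ex'; apply: idealM.
have Jd : J d.
  by apply/JE; exists w, 0; rewrite addr0 -Ed; split=> //; apply: ideal0.
have Axc : A (x * c) by apply: ac; rewrite -Ex; apply: idealM.
have [y Ey] := sA _ Axc.
pose z := w * u * s k - y * d.
have zxc : z * (x * c) = 0.
  have -> : z * (x * c) = w * u * (s k * (x * c)) - y * x * (d * c).
    by rewrite /z; ring.
  rewrite Ey -Ed.
  have -> : w * u * (y * al k) = w * y * (u * al k) by ring.
  by rewrite Ex; ring.
have qe : z * w * u * al k = 0.
  rewrite -mulrA Ex.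
  have -> : z * w * (x * a) = z * x * (w * a) by ring.
  rewrite Ed; have -> : z * x * (d * c) = d * (z * (x * c)) by ring.
  by rewrite zxc mulr0.
apply/TE; exists (s k * (s k - z * w * u)), (s k * (z * w * u)); split.
- apply: idealM.
  have -> : s k - z * w * u = (s k * (1 + w)) * (1 - w)
      + (s k * w * w * (1 + u)) * (1 - u) + (y * w * u) * d.
    by rewrite /z; ring.
  by do ?[apply: idealD]; apply: idealM.
- apply/NE => v /sA[p Ep].
  have -> : s k * (z * w * u) * v = z * w * u * (s k * v) by ring.
  by rewrite Ep mulrCA qe mulr0.
- by rewrite -mulrDr subrK.
Qed.

(** With [w a = d c], the element [d] is regular up to factors in [1 + J], where
    [J] consists of the multipliers that send [c] into [R a]. *)
Lemma annihilator_comparison (R : comPzRingType) (a c : R) :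
  bezout_locally R -> (forall r, r * a = 0 -> r * c = 0) ->
  exists w d : R, [/\ principal a ((1 - w) * c), d * c = w * a
    & forall r, d * r = 0 ->
        exists j : R, principal a (j * c) /\ (1 - j) * r = 0].
Proof.
move=> bR ac; have [w [[d Ed] [d' Ed']]] := bR a c.
exists w, d; split=> //; first by exists d'.
move=> r dr; have [q [[x Ex] [y Ey]]] := bR r c.
have qwc : (1 - q) * w * c = 0.
  apply: ac; rewrite -mulrA Ed mulrCA Ey mulrCA dr mulr0; by [].
have xwc : x * w * c = 0.
  by apply: ac; rewrite -mulrA Ed mulrCA -Ex mulrCA dr mulr0.
exists ((1 - w) + (1 - q) * w); split.
  by exists d'; rewrite mulrDl Ed' qwc addr0.
have -> : (1 - ((1 - w) + (1 - q) * w)) * r = w * (q * r) by ring.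
by rewrite Ex mulrCA mulrA.
Qed.

(** * Rings whose nilradical is a prime concentrated at one point *)

Definition nilp (R : comPzRingType) (x : R) := exists k, x ^+ k = 0.

(** The last condition says that the localization of a nilpotent element vanishes
    at all primes that are not contained in [L]. Domains, local rings and torch
    rings have this property, if they are arithmetical. *)
Definition concentrated_nilradical (R : comPzRingType) :=
  [/\ ~ nilp (1 : R), forall x y : R, nilp (x * y) -> nilp x \/ nilp y
    & exists L : spec R, forall x u : R, nilp x -> ~ L u ->
        exists v, (1 - v * u) * x = 0].

Lemma nilp_prime (R : comPzRingType) (P : spec R) (x : R) : nilp x -> P x.
Proof.
by case=> k xk; apply: (@spec_prime_exp _ _ _ k); rewrite xk; apply: ideal0.
Qed.

Lemma nilp_unit (R : comPzRingType) (x : R) :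
  nilp x -> exists v, v * (1 - x) = 1.
Proof.
case=> k xk; exists (\sum_(i < k) x ^+ i).
have := subrX1 x k; rewrite xk sub0r => /(congr1 -%R).
by rewrite opprK -mulNr opprB mulrC => /esym.
Qed.

Lemma nilp_exp (R : comPzRingType) (x : R) k : nilp x -> nilp (x ^+ k.+1).
Proof. by case=> m xm; exists m; rewrite -exprM mulnC exprM xm expr0n. Qed.

(** If [A] is not nil, its annihilator is, and [c] itself lies in [R a + A]. If
    [A] is nil, any multiplier outside [L] is regular modulo [A]. If there is none,
    then [A = 0] because its annihilator is not contained in [L], and [d], with
    [d c = w a], is a regular element. *)
Lemma concentrated_multiplier (R : comPzRingType) (I : finType)
    (al : I -> R) (A : ideal R) (a c : R) :
  bezout_locally R -> concentrated_nilradical R -> generates al A ->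
  (forall r : R, A (r * a) -> A (r * c)) ->
  exists s x y : R,
    [/\ forall r : R, A (s * r) -> A r, s * c = x * a + y & A y].
Proof.
move=> bR [nil1 nilM [L LP]] genA ac.
have [J JE] := multiplier_idealP A a c.
have [j [n [Jj An E]]] := multiplier_or_annihilator bR genA ac JE.
have torsion x u : nilp x -> ~ L u -> u * x = 0 -> x = 0.
  move=> nx Lu ux; have [v] := LP x u nx Lu.
  by rewrite mulrBl mul1r -mulrA ux mulr0 subr0.
have [[x0 Ax0 nx0]|Anil] := pselect (exists2 x : R, A x & ~ nilp x).
  have /nilp_unit[v vE] : nilp n.
    by have [|//|//] := nilM n x0; exists 1%N; rewrite expr1 An.
  have /JE[x [y [Exy Ay]]] : J 1.
    by rewrite -vE E addrK; apply: idealM.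
  by exists 1, x, y; split=> // r; rewrite mul1r.
have {}Anil x : A x -> nilp x.
  by move=> Ax; apply: contrapT => nx; apply: Anil; exists x.
have [[u Ju Lu]|JL] := pselect (exists2 u : R, J u & ~ L u).
  have [x [y [Exy Ay]]] := proj1 (JE u) Ju; exists u, x, y; split=> // r Aur.
  case: (nilM u r (Anil _ Aur)) => [/nilp_prime/Lu//|nr].
  have [v /eqP] := LP r u nr Lu; rewrite mulrBl mul1r subr_eq0 => /eqP->.
  by rewrite -mulrA; apply: idealM.
have {}JL u : J u -> L u.
  by move=> Ju; apply: contrapT => Lu; apply: JL; exists u.
have L1 : ~ L 1 by apply: spec_proper.
have A0 x : A x -> x = 0.
  move=> Ax; apply: (torsion x n); [exact: Anil | | exact: An].
  by move=> Ln; apply: L1; rewrite E; apply: idealD => //; apply: JL.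
have ac0 r : r * a = 0 -> r * c = 0.
  by move=> ra; apply/A0/ac; rewrite ra; apply: ideal0.
have [w [d [Pw Ed dr]]] := annihilator_comparison bR ac0.
have kill r : d * r = 0 -> exists2 q : R, ~ L q & q * r = 0.
  move/dr=> [i [[x Ei] ir]]; exists (1 - i) => // Li.
  apply: (spec_subr1 _ Li).
  by apply/JL/JE; exists x, 0; rewrite addr0; split=> //; apply: ideal0.
have d_not_nil k : d ^+ k <> 0.
  elim: k => [|k IHk]; first by move=> d0; apply: nil1; exists 1%N.
  move=> dk; have [|q Lq qk] := kill (d ^+ k); first by rewrite -exprS.
  case: k IHk dk qk => [_ _|k IHk dk qk].
    by rewrite expr0 mulr1 => q0; apply: Lq; rewrite q0; apply: ideal0.
  by apply: IHk; apply: (torsion _ q) => //; apply: nilp_exp; exists k.+2.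
exists d, w, 0; rewrite addr0; split=> //; last exact: ideal0.
move=> r /A0 dr0; suff -> : r = 0 by apply: ideal0.
have [|[k /d_not_nil//]|nr] := nilM d r; first by exists 1%N; rewrite expr1.
by have [q Lq qr] := kill r dr0; apply: (torsion r q).
Qed.
(** * Pierce stalks *)

Section PierceIdeal.
Context (R : comPzRingType) (P : spec R).

Let A (r : R) := exists e : R, [/\ e * e = e, ~ P e & e * r = 0].

Lemma pierce_ideal0 : A 0.
Proof.
by exists 1; split; rewrite ?mulr1 ?mulr0 //; apply: spec_proper.
Qed.

Lemma pierce_idealD x y : A x -> A y -> A (x + y).
Proof.
move=> [e [ee Pe ex]] [f [ff Pf fy]]; exists (e * f); split.
- by rewrite mulrACA ee ff.
- exact: spec_complM.
- by rewrite mulrDr {1}[e * f]mulrC -!mulrA ex fy !mulr0 addr0.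
Qed.

Lemma pierce_idealM a x : A x -> A (a * x).
Proof. by move=> [e [ee Pe ex]]; exists e; rewrite mulrCA ex mulr0. Qed.

(** This is the ideal generated by the idempotents of [P]: if [e] is an idempotent
    outside [P] then [1 - e] belongs to [P], and [e r = 0] means
    [r = (1 - e) r]. *)
Definition pierce_ideal : ideal R :=
  mk_ideal pierce_ideal0 pierce_idealD pierce_idealM.

End PierceIdeal.

Definition pierce_stalk (R : comPzRingType) (P : spec R) : comPzRingType :=
  ring_quot (pierce_ideal P).

Lemma quot_pi_surj (R : comPzRingType) (I : ideal R) (y : ring_quot I) :
  exists x, quot_pi I x = y.
Proof. by exists (repr y)%qT; apply: quot_piK. Qed.

Lemma quot_pi0 (R : comPzRingType) (I : ideal R) (x : R) :
  quot_pi I x = 0 <-> I x.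
Proof.
by rewrite -[0](rmorph0 (quot_pi I)) quot_piP subr0.
Qed.

Lemma pierce0 (R : comPzRingType) (P : spec R) (x : R) :
  quot_pi (pierce_ideal P) x = 0 <->
  exists e : R, [/\ e * e = e, ~ P e & e * x = 0].
Proof. exact: quot_pi0. Qed.

Lemma idem_compl (R : comPzRingType) (e : R) :
  e * e = e -> (1 - e) * (1 - e) = 1 - e.
Proof. by move=> ee; rewrite mulrBl mul1r mulrBr mulr1 ee subrr subr0. Qed.

Lemma pierce_idem1 (R : comPzRingType) (P : spec R) (e : R) :
  e * e = e -> ~ P e -> quot_pi (pierce_ideal P) e = 1.
Proof.
move=> ee Pe; apply/subr0_eq; rewrite -(rmorph1 (quot_pi _)) -rmorphB.
by apply/pierce0; exists e; rewrite mulrBr mulr1 ee subrr.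
Qed.

Lemma pierce_idem0 (R : comPzRingType) (P : spec R) (e : R) :
  e * e = e -> P e -> quot_pi (pierce_ideal P) e = 0.
Proof.
move=> ee Pe; apply/pierce0; exists (1 - e); split; first exact: idem_compl.
  exact: spec_subr1.
by rewrite mulrBl mul1r ee subrr.
Qed.

Lemma pierce_idem (R : comPzRingType) (P : spec R) (e : R) :
  e * e = e -> quot_pi (pierce_ideal P) e = 0 \/ quot_pi (pierce_ideal P) e = 1.
Proof.
move=> ee; have [Pe|Pe] := EM (P e); first by left; apply: pierce_idem0.
by right; apply: pierce_idem1.
Qed.

Lemma colon_generators (R : comPzRingType) (I : finType) (al : I -> R)
    (A : ideal R) (s : R) :
  syzygies_fg R -> generates al A ->
  exists (J : finType) (r : J -> R), (forall j, A (s * r j)) /\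
    forall x : R, A (s * x) -> exists d : J -> R, x = \sum_j d j * r j.
Proof.
move=> sR genA.
pose f (k : 'I_1 + I) := match k with inl _ => s | inr i => al i end.
have [J [b [bf bc]]] := sR _ f.
exists J, (fun j => b j (inl ord0)); split.
  move=> j; have := bf j; rewrite big_sumType big_ord1 /= mulrC => /eqP.
  rewrite addr_eq0 => /eqP->; apply: idealN; apply/genA.
  by exists (fun i => b j (inr i)).
move=> x /genA[c cE].
have [|d dE] := bc (fun k => match k with inl _ => x | inr i => - c i end).
  rewrite big_sumType big_ord1 /= mulrC cE.
  under [X in _ + X]eq_bigr => i _ do rewrite mulNr.
  by rewrite sumrN subrr.
by exists d; rewrite (dE (inl ord0)).
Qed.

(** The solution in the stalk lifts to [R]. Regularity of [s] modulo [A] is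
    tested on finitely many generators of the ideal of those [r] with [s r] in
    [A], so that it holds on the clopen set of an idempotent [g]. *)
Lemma multiplier_near (R : comPzRingType) (I : finType) (al : I -> R)
    (A : ideal R) (a c : R) (P : spec R) :
  syzygies_fg R -> bezout_locally R ->
  concentrated_nilradical (pierce_stalk P) -> generates al A ->
  (forall r : R, A (r * a) -> A (r * c)) ->
  exists g s x y : R, [/\ g * g = g, ~ P g,
    forall r : R, A (g * s * r) -> A (g * r), g * s * c = x * a + y & A y].
Proof.
move=> sR bR PR genA ac.
pose pi : {rmorphism R -> pierce_stalk P} := quot_pi (pierce_ideal P).
have bS : bezout_locally (pierce_stalk P).
  exact: (bezout_locally_surj (f := pi) (@quot_pi_surj _ _)) bR.
have [A' genA'] := combination_idealP (fun i => pi (al i)).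
have A'E (x : R) :
    A' (pi x) <-> exists e : R, [/\ e * e = e, ~ P e & A (e * x)].
  split.
    case/genA' => c' Ec'.
    have [c2 c2E] := choice (fun i => quot_pi_surj (c' i)).
    have : pi (x - \sum_i c2 i * al i) = 0.
      rewrite rmorphB rmorph_sum Ec' /=; apply/eqP; rewrite subr_eq0; apply/eqP.
      by apply: eq_bigr => i _; rewrite -c2E -rmorphM.
    case/pierce0 => e [ee Pe /eqP]; rewrite mulrBr subr_eq0 => /eqP E.
    exists e; split=> //; rewrite E; apply: idealM; apply/genA.
    by exists c2.
  case=> e [ee Pe /genA[b bE]]; apply/genA'; exists (fun i => pi (b i)).
  rewrite -[LHS]mul1r -(pierce_idem1 ee Pe) -rmorphM bE rmorph_sum.
  by apply: eq_bigr => i _; rewrite -rmorphM.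
have [|s' [x' [y' [regs Es Ay']]]] :=
    @concentrated_multiplier _ _ _ A' (pi a) (pi c) bS PR genA'.
  move=> r'; have [r <-] := quot_pi_surj r'; rewrite -!rmorphM.
  move=> /A'E[e [ee Pe Ae]]; apply/A'E; exists e; split=> //.
  by rewrite mulrA; apply: ac; rewrite -mulrA.
have [s sE] := quot_pi_surj s'; have [x xE] := quot_pi_surj x'.
have [y yE] := quot_pi_surj y'; subst s' x' y'.
have [e1 [ee1 Pe1 Ay]] := proj1 (A'E y) Ay'.
have [e2 [ee2 Pe2 Es2]] :
    exists e : R, [/\ e * e = e, ~ P e & e * (s * c - (x * a + y)) = 0].
  by apply/pierce0; rewrite rmorphB rmorphD !rmorphM /= Es subrr.
have [J [r [Ar rgen]]] := colon_generators s sR genA.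
have eP j : exists e : R, [/\ e * e = e, ~ P e & A (e * r j)].
  apply/A'E; apply: regs; rewrite -rmorphM; apply/A'E; exists 1.
  by rewrite !mul1r; split=> //; apply: spec_proper.
have [e eE] := choice eP.
have [E [EE PE Er]] :
    exists E : R, [/\ E * E = E, ~ P E & forall j, A (E * r j)].
  suff [E [EE PE Er]] : exists E : R, [/\ E * E = E, ~ P E
      & forall j, j \in index_enum J -> A (E * r j)].
    by exists E; split=> // j; apply: Er; rewrite mem_index_enum.
  elim: (index_enum J) => [|j l [E [EE PE Er]]].
    by exists 1; split=> //; rewrite ?mulr1 //; apply: spec_proper.
  have [eej Pej Aej] := eE j; exists (e j * E); split.
  - by rewrite mulrACA eej EE.
  - exact: spec_complM.
  - move=> k; rewrite inE => /predU1P[->|/Er AE].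
      by rewrite mulrAC [_ * E]mulrC; apply: idealM.
    by rewrite -mulrA; apply: idealM.
exists (E * (e1 * e2)), s, (E * e1 * e2 * x), (E * e2 * (e1 * y)); split.
- by rewrite mulrACA EE mulrACA ee1 ee2.
- by do ?[apply: spec_complM].
- move=> q Aq; set g := E * (e1 * e2) in Aq *.
  have [|d dE] := rgen (g * q); first by rewrite mulrA [s * g]mulrC.
  have -> : g * q = E * (g * q) by rewrite /g !mulrA EE.
  rewrite dE mulr_sumr; apply: ideal_sum => j.
  by rewrite mulrCA; apply: idealM.
- move/eqP: Es2; rewrite mulrBr subr_eq0 => /eqP Es2.
  transitivity (E * e1 * (e2 * (s * c))); first by ring.
  by rewrite Es2; ring.
- exact: idealM.
Qed.

(** The idempotents on whose clopen set a solution exists are stable under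
    disjoint joins, so the ideal of [R] that they generate consists of their
    multiples; and no maximal ideal contains it. *)
Lemma multiplier_global (R : comPzRingType) (I : finType) (al : I -> R)
    (A : ideal R) (a c : R) :
  syzygies_fg R -> bezout_locally R ->
  (forall P : spec R, concentrated_nilradical (pierce_stalk P)) ->
  generates al A -> (forall r : R, A (r * a) -> A (r * c)) ->
  exists s x y : R,
    [/\ forall r : R, A (s * r) -> A r, s * c = x * a + y & A y].
Proof.
move=> sR bR PR genA ac.
pose solvable (g : R) := g * g = g /\ exists s x y : R,
  [/\ forall r : R, A (g * s * r) -> A (g * r), g * s * c = x * a + y & A y].
have [T TE] : exists T : ideal R,
    forall x : R, T x <-> exists2 g, solvable g & g * x = x.
  unshelve eexists (@mk_ideal R
    (fun x => exists2 g, solvable g & g * x = x) _ _ _) => //.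
  - exists 0; rewrite ?mulr0 //; split; rewrite ?mulr0 //; exists 0, 0, 0.
    split=> [r _||]; rewrite ?mul0r ?addr0 //; exact: ideal0.
  - move=> x x' [g [gg [s [p [y [gs Eg Ay]]]]] gx].
    move=> [g' [gg' [s' [p' [y' [gs' Eg' Ay']]]]] gx'].
    have g0 : g * (1 - g) = 0 by rewrite mulrBr mulr1 gg subrr.
    pose h := g + (1 - g) * g'.
    have gh : g * h = g by rewrite /h mulrDr gg mulrA g0 mul0r addr0.
    have ch : (1 - g) * h = (1 - g) * g'.
      by rewrite /h mulrDr mulrC g0 add0r mulrA idem_compl.
    have hsplit z : h * z = g * z + (1 - g) * g' * z by rewrite /h mulrDl.
    exists h; last first.
      have hx : h * x = x by rewrite -gx mulrA [h * g]mulrC gh.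
      have hx' : h * x' = x'.
        by rewrite hsplit -mulrA gx' -mulrDl addrC subrK mul1r.
      by rewrite mulrDr hx hx'.
    split.
      by rewrite {1}/h mulrDl gh -mulrA [g' * h]mulrC mulrA ch -mulrA gg'.
    pose s2 := g * s + (1 - g) * s'.
    have hs2 : h * s2 = g * s + (1 - g) * (g' * s').
      rewrite /s2 mulrDr mulrA [h * g]mulrC gh mulrA [h * _]mulrC ch.
      by rewrite -mulrA.
    have ghs : g * (h * s2) = g * s.
      by rewrite hs2 mulrDr mulrA gg mulrA g0 mul0r addr0.
    have chs : (1 - g) * (h * s2) = (1 - g) * (g' * s').
      transitivity (g * (1 - g) * s + (1 - g) * (1 - g) * (g' * s')).
        by rewrite hs2; ring.
      by rewrite g0 idem_compl // mul0r add0r.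
    exists s2, (p + (1 - g) * p'), (y + (1 - g) * y'); split.
    + move=> r Ar; rewrite hsplit; apply: idealD.
        apply: gs; have -> : g * s * r = g * (h * s2 * r); last exact: idealM.
        by rewrite mulrA ghs.
      rewrite [(1 - g) * g']mulrC -mulrA; apply: gs'.
      have -> : g' * s' * ((1 - g) * r) = (1 - g) * (h * s2 * r);
        last exact: idealM.
      by rewrite [RHS]mulrA chs; ring.
    + by rewrite hs2 mulrDl Eg -mulrA Eg'; ring.
    + by apply: idealD => //; apply: idealM.
  - by move=> b x [g gS gx]; exists g; rewrite // mulrCA gx.
have : T 1.
  apply: ideal_all => P _ TP.
  have [g [s [x [y [gg Pg gs Eg Ay]]]]] := multiplier_near sR bR (PR P) genA ac.
  apply: Pg; apply: TP; apply/TE; exists g => //; split=> //.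
  by exists s, x, y.
case/TE => g [_ [s [x [y [gs Eg Ay]]]]]; rewrite mulr1 => g1.
subst g; exists s, x, y; split=> // [r|]; last by rewrite -Eg mul1r.
by have := gs r; rewrite !mul1r.
Qed.
(** In the total quotient ring of [R / A], an element [a] with finitely generated
    annihilator satisfies the double annihilator condition when every [c] killed
    by the annihilator of [a] has a regular multiple in [R a]. *)
Lemma stalks_finitely_fractionally_IF (R : comPzRingType) :
  syzygies_fg R -> bezout_locally R ->
  (forall P : spec R, concentrated_nilradical (pierce_stalk P)) ->
  finitely_fractionally_IF R.
Proof.
move=> sR bR PR A [n [al genA]]; pose S : comPzRingType := ring_quot A.
pose pi : {rmorphism R -> S} := quot_pi A.
pose Q : comPzRingType := total_quot S.
have piM x y : pi x * pi y = pi (x * y) by rewrite rmorphM.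
have pi0 x : pi x = 0 <-> A x := quot_pi0 A x.
have bQ : bezout_locally Q.
  apply: bezout_locally_loc.
  exact: (bezout_locally_surj (f := pi) (@quot_pi_surj _ _)) bR.
apply: double_annihilator_IF; apply: double_annihilator_elements => // q.
have [a' [s ->]] := frac_surj q; have [a aE] := quot_pi_surj a'; subst a'.
have genA' : generates (al : 'I_n -> R) A by exact: genA.
have [J [r [Ar rgen]]] := colon_generators a sR genA'.
exists J, (fun j => loc_of (regular_elements S) (pi (r j))); split.
  move=> j; rewrite -[LHS]/(loc_mul _ _) loc_mulE.
  apply: (frac_eq (S := regular_elements S)); rewrite mul0r [LHS]mulr1.
  by rewrite (piM (r j) a) mulrC; apply/pi0.
move=> v vr; have [c' [t vE]] := frac_surj v.
have [c cE] := quot_pi_surj c'; subst c' v.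
have Arc j : A (r j * c).
  have := vr j; rewrite -[LHS]/(loc_mul _ _) loc_mulE => /fracP[u ureg].
  rewrite mul0r mulr0 mulr1 -[0](mulr0 u) => /ureg.
  by rewrite -[quot_pi A c]/(pi c) piM => /pi0.
have [|x [y [z [xreg E Az]]]] :=
    multiplier_global (c := c) (a := a) sR bR PR genA'.
  move=> w; rewrite mulrC => /rgen[d ->]; rewrite mulr_suml.
  by apply: ideal_sum => j; rewrite -mulrA; apply: idealM.
apply: (@frac_principal S (regular_elements S) _ _ (pi x) (pi y)).
  move=> p1 p2.
  have [[q1 <-] [q2 <-]] := (quot_pi_surj p1, quot_pi_surj p2).
  rewrite -[quot_pi A q1]/(pi q1) -[quot_pi A q2]/(pi q2) !piM => /quot_piP.
  by rewrite -mulrBr => /xreg; rewrite -quot_piP.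
rewrite -[quot_pi A c]/(pi c) -[quot_pi A a]/(pi a) !piM E rmorphD.
by rewrite (proj2 (pi0 z) Az) addr0.
Qed.

(** * Domains, local rings and torch rings *)

Lemma nilpM (R : comPzRingType) (a x : R) : nilp x -> nilp (a * x).
Proof. by case=> k xk; exists k; rewrite exprMn xk mulr0. Qed.

Lemma nilp_sqr (R : comPzRingType) (x : R) : nilp (x * x) -> nilp x.
Proof. by case=> k xk; exists (2 * k)%N; rewrite exprM expr2. Qed.

Lemma spec_inhabited (R : comPzRingType) : (1 : R) <> 0 -> inhabited (spec R).
Proof.
move=> R1; have [I IE] := zero_idealP R.
by have [/IE|P _ _] := @maximal_containing R I.
Qed.

Lemma domain_concentrated (R : comPzRingType) :
  domain R -> concentrated_nilradical R.
Proof.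
case=> R1 intR.
have nilp0 (x : R) : nilp x -> x = 0.
  case=> k; elim: k => [/R1//|k IHk].
  by rewrite exprS => /intR/orP[/eqP|/eqP/IHk].
split; first by move=> /nilp0.
  move=> x y /nilp0/intR/orP[] /eqP->; [left|right]; exists 1%N;
    exact: expr1.
have [L] := spec_inhabited R1; exists L => x u /nilp0-> _.
by exists 0; rewrite mulr0.
Qed.

(** The set of non-units is then an ideal. *)
Lemma unit_or_concentrated (R : comPzRingType) :
  bezout_locally R -> (1 : R) <> 0 ->
  (forall x : R, (exists v, v * x = 1) \/ exists v, v * (1 - x) = 1) ->
  concentrated_nilradical R.
Proof.
move=> bR R1 unitR.
have nilp_of x y s : (exists v, v * s = 1) -> principal y (s * x) ->
    nilp (x * y) -> nilp x.
  move=> [v vs] [t Et] nxy; apply: nilp_sqr.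
  have -> : x * x = (v * t) * (x * y); last exact: nilpM.
  transitivity (v * (s * x) * x); first by rewrite mulrA vs mul1r.
  by rewrite Et; ring.
split; first by case=> k; rewrite expr1n.
  move=> x y nxy; have [s [Es Es']] := bR x y.
  case: (unitR s) => us; first by left; apply: nilp_of us Es nxy.
  by right; apply: nilp_of us Es' _; rewrite mulrC.
have [L LE] : exists L : ideal R, forall x : R, L x <-> ~ exists v, v * x = 1.
  unshelve eexists (@mk_ideal R (fun x => ~ exists v, v * x = 1) _ _ _) => //.
  - by case=> v; rewrite mulr0 => /esym.
  - move=> x y nx ny [v vxy]; case: (unitR (v * x)) => [[w]|[w]].
      by rewrite mulrA => wx; apply: nx; exists (w * v).
    have -> : 1 - v * x = v * y by rewrite -vxy mulrDr addrC addKr.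
    by rewrite mulrA => wy; apply: ny; exists (w * v).
  - by move=> a x nx [v]; rewrite mulrA => vx; apply: nx; exists (v * a).
have L1 : ~ L 1 by move/LE; apply; exists 1; rewrite mulr1.
unshelve eexists (@Spec R L L1 _).
  move=> x y /LE nxy; apply: contrapT => /not_orP[nx ny].
  have [v vx] : exists v, v * x = 1 by apply: contrapT => /LE.
  have [w wy] : exists w, w * y = 1 by apply: contrapT => /LE.
  by apply: nxy; exists (w * v); rewrite mulrACA [w * x]mulrC mulrACA
    -[RHS]mul1r -{1}vx -wy; ring.
move=> x u _ /= nLu.
have [v vu] : exists v, v * u = 1 by apply: contrapT => /LE.
by exists v; rewrite vu subrr mul0r.
Qed.

Lemma local_unit_or (R : comPzRingType) :
  local_ring R ->
  forall x : R, (exists v, v * x = 1) \/ exists v, v * (1 - x) = 1.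
Proof.
case=> L [[L1 _] Luniq] x.
have nonunit (y : R) : ~ (exists v, v * y = 1) -> L y.
  move=> ny; have [I IE] := ideal_principalP y.
  have [/IE[v vy]|P IP Pmax] := @maximal_containing R I.
    by apply: ny; exists v.
  by rewrite -(Luniq _ Pmax); apply: IP; apply/IE; exists 1; rewrite mul1r.
apply: contrapT => /not_orP[/nonunit Lx /nonunit Lx'].
by apply: L1; rewrite -[1](subrK x); apply: idealD.
Qed.

Lemma local_concentrated (R : comPzRingType) :
  bezout_locally R -> local_ring R -> concentrated_nilradical R.
Proof.
move=> bR locR; apply: unit_or_concentrated => //; last exact: local_unit_or.
case: locR => L [[L1 _] _] R0; apply: L1.
by rewrite R0; apply: ideal0.
Qed.

(** The nilradical of the localization at [P], pulled back: as the localization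
    is a valuation ring, this is the smallest prime contained in [P]. *)
Lemma generic_prime (R : comPzRingType) (P : spec R) :
  bezout_locally R ->
  exists N : spec R, submod_le N P /\
    forall x : R, N x <-> exists u k, ~ P u /\ u * x ^+ k = 0.
Proof.
move=> bR; have PX (u : R) k : ~ P u -> ~ P (u ^+ k).
  by move=> Pu /spec_prime_exp.
have shift (x u : R) k m : u * x ^+ k = 0 -> u * x ^+ (k + m) = 0.
  by rewrite exprD mulrA => ->; rewrite mul0r.
have [N NE] : exists N : ideal R,
    forall x : R, N x <-> exists u k, ~ P u /\ u * x ^+ k = 0.
  unshelve eexists (@mk_ideal R
    (fun x => exists u k, ~ P u /\ u * x ^+ k = 0) _ _ _) => //.
  - by exists 1, 1%N; rewrite expr1 mulr0; split=> //; apply: spec_proper.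
  - move=> x y [u [k [Pu ux]]] [v [m [Pv vy]]]; exists (u * v), (k + m)%N.
    split; first exact: spec_complM.
    rewrite exprDn mulr_sumr big1 // => i _; rewrite mulrnAr.
    have [le_im|lt_mi] := leqP i m.
      have -> : (k + m - i = k + (m - i))%N by rewrite addnBA.
      rewrite mulrA -[u * v * _]mulrAC shift // !mul0r; exact: mul0rn.
    rewrite mulrCA -[u * v * _]mulrA -[X in v * y ^+ X](subnKC (ltnW lt_mi)).
    by rewrite shift // !mulr0 mul0rn.
  - move=> a x [u [k [Pu ux]]]; exists u, k; split=> //.
    by rewrite exprMn mulrCA ux mulr0.
have NP : submod_le N P.
  move=> x /NE[u [k [Pu ux]]]; apply: contrapT => Px.
  apply: (spec_complM Pu (PX _ k Px)); rewrite ux; exact: ideal0.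
have N1 : ~ N 1 by move=> /NP; apply: spec_proper.
unshelve eexists (@Spec R N N1 _); last by [].
have half x y s : ~ P s -> principal y (s * x) -> N (x * y) -> N x.
  move=> Ps [t Et] /NE[u [k [Pu uxy]]]; apply/NE.
  exists (u * s ^+ k), (k + k)%N; split.
    by apply: spec_complM => //; apply: PX.
  rewrite exprD -mulrA [s ^+ k * _]mulrA -exprMn Et !exprMn.
  transitivity (t ^+ k * (u * (x * y) ^+ k)); last by rewrite uxy mulr0.
  by rewrite exprMn; ring.
move=> x y Nxy; have [s [Es Es']] := bR x y.
have [Ps|Ps] := EM (P s); last by left; apply: half Ps Es Nxy.
right; apply: (half _ _ (1 - s)) Es' _; last by rewrite mulrC.
exact: spec_subr1.
Qed.

(** [L] is the maximal ideal over the annihilator of a nonzero element of [N]. It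
    serves for all of [N], because cyclic submodules are comparable. For [u]
    outside [L] and [x] in [N], write [1 = w u + l] with [l] in [L]: either [l x]
    is a multiple of [u x], and then so is [x], or [u x] is a multiple of [l x],
    and then so is [x], which therefore vanishes by Nakayama's lemma. *)
Lemma torch_concentrated (R : comPzRingType) :
  bezout_locally R -> torch_ring R -> concentrated_nilradical R.
Proof.
move=> bR [_ _ [N [Nmin Nuniq [a Na a0] uniN]]].
have compare (x y : R) : N x -> N y -> principal y x \/ principal x y.
  move=> Nx Ny.
  have cyc (z : R) : N z -> exists K : submod (submod_type N),
      forall w, K w <-> principal z (\val w : R).
    move=> Nz; unshelve eexists (@Submod R (submod_type N)
      (fun w => principal z (\val w : R)) _ _ _) => //.
    - by exists 0; rewrite mul0r.
    - by move=> w w' [r Er] [r' Er']; exists (r + r'); rewrite mulrDl -Er -Er'.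
    - by move=> b w [r Er]; exists (b * r); rewrite -mulrA -Er.
  have [K KE] := cyc x Nx; have [M ME] := cyc y Ny.
  have [xN xE] := submod_elt Nx; have [yN yE] := submod_elt Ny.
  case: (uniN K M) => sub; [left|right].
    rewrite -xE; apply/ME/sub/KE; exists 1; rewrite xE mul1r; by [].
  rewrite -yE; apply/KE/sub/ME; exists 1; rewrite yE mul1r; by [].
have [Ann AnnE] := annihilator_idealP a.
have [|L AL Lmax] := @maximal_containing R Ann.
  by move=> /AnnE; rewrite mul1r.
have L1 : ~ L 1 by apply: spec_proper.
have inv (u : R) : ~ L u -> exists w l, L l /\ 1 = w * u + l.
  move=> Lu; apply: contrapT => no; apply: Lu.
  have [I IE] := ideal_principalP u; have [K KE] := ideal_addP I L.
  apply: (proj2 Lmax K); last by apply/KE; exists u, 0; split;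
    [apply/IE; exists 1; rewrite mul1r | apply: ideal0 | rewrite addr0].
    move=> z Lz; apply/KE; exists 0, z; rewrite add0r; split=> //.
    exact: ideal0.
  by case/KE=> i [l [/IE[w ->] Ll E]]; apply: no; exists w, l.
(* Nakayama's lemma for the cyclic submodules of N. *)
have nakayama (x l : R) : N x -> L l -> (1 - l) * x = 0 -> x = 0.
  move=> Nx Ll lx; have L1l : ~ L (1 - l).
    exact: spec_subr1.
  have [[r xE]|[r aE]] := compare x a Nx Na; last first.
    by case: L1l; apply/AL/AnnE; rewrite aE mulrCA lx mulr0.
  have [||[t Et]|[t Et]] := compare (l * a) ((1 - l) * a).
  - exact: idealM.
  - exact: idealM.
  - rewrite -[x](subrK (l * x)) -{1}[x]mul1r -mulrBl lx add0r.
    rewrite {1}xE mulrCA Et.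
    transitivity (t * ((1 - l) * (r * a))); first by ring.
    by rewrite -xE lx mulr0.
  - case: L1; rewrite -[1](subrK l); apply: idealD => //.
    rewrite -[1 - l](subrK (t * l)); apply: idealD; last exact: idealM.
    by apply/AL/AnnE; rewrite mulrBl Et mulrA subrr.
have solve (x u : R) : N x -> ~ L u -> exists v, (1 - v * u) * x = 0.
  move=> Nx /inv[w [l [Ll E]]].
  have [||[t Et]|[t Et]] := compare (l * x) (u * x).
  - exact: idealM.
  - exact: idealM.
  - exists (w + t); have -> : 1 - (w + t) * u = l - t * u by rewrite E; ring.
    by rewrite mulrBl Et mulrA subrr.
  - exists 0; rewrite mul0r subr0 mul1r.
    apply: (nakayama x ((w * t + 1) * l)) => //.
      exact: idealM.
    transitivity (w * (u * x) - w * (t * (l * x))); last by rewrite Et subrr.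
    by rewrite {1}E; ring.
have torsion (x u : R) : N x -> ~ L u -> u * x = 0 -> x = 0.
  move=> Nx Lu ux; have [v] := solve x u Nx Lu.
  by rewrite mulrBl mul1r -mulrA ux mulr0 subr0.
have nilN (x : R) : N x <-> nilp x.
  split; last exact: nilp_prime.
  have [NL [NLL NLE]] := generic_prime L bR.
  have NNL : NL = N.
    apply: Nuniq => P PNL y /NLE[u [k [Lu uy]]].
    have Pu : ~ P u by move=> /PNL/NLL.
    have : P (u * y ^+ k) by rewrite uy; apply: ideal0.
    by case/spec_prime=> [//|]; apply: spec_prime_exp.
  move=> Nx; have [u [k [Lu uxk]]] : exists u k, ~ L u /\ u * x ^+ k = 0.
    by apply/NLE; rewrite NNL.
  exists k; case: k uxk => [|k] uxk.
    by case: Lu; move: uxk; rewrite expr0 mulr1 => ->; apply: ideal0.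
  by apply: (torsion _ u) => //; rewrite exprSr; apply: idealM.
split.
- by case=> k; rewrite expr1n => R0; apply: a0; rewrite -[a]mul1r R0 mul0r.
- by move=> x y /nilN/spec_prime[/nilN|/nilN]; [left|right].
- by exists L => x u /nilN; apply: solve.
Qed.
(** * The Pierce stalks of the rings considered *)

Lemma pierce_stalk_neq0 (R : comPzRingType) (P : spec R) :
  (1 : pierce_stalk P) <> 0.
Proof.
rewrite -[1](rmorph1 (quot_pi (pierce_ideal P))) => /pierce0[e [_ Pe]].
by rewrite mulr1 => e0; apply: Pe; rewrite e0; apply: ideal0.
Qed.

Lemma pierce_stalk_bezout (R : comPzRingType) (P : spec R) :
  bezout_locally R -> bezout_locally (pierce_stalk P).
Proof.
apply: (bezout_locally_surj (f := quot_pi (pierce_ideal P))).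
exact: quot_pi_surj.
Qed.

Lemma clean_stalk (R : comPzRingType) (P : spec R) :
  bezout_locally R -> clean R -> concentrated_nilradical (pierce_stalk P).
Proof.
move=> bR cleanR; apply: unit_or_concentrated.
- exact: pierce_stalk_bezout.
- exact: pierce_stalk_neq0.
move=> x'; have [x <-] := quot_pi_surj x'.
have [e [u [-> ee [v uv]]]] := cleanR x; rewrite rmorphD /=.
have /(congr1 (quot_pi (pierce_ideal P))) := uv; rewrite rmorphM rmorph1 => uv'.
case: (pierce_idem P ee) => ->; [left|right].
  by exists (quot_pi _ v); rewrite add0r mulrC.
exists (- quot_pi _ v); rewrite opprD addrA subrr add0r mulrNN mulrC.
exact: uv'.
Qed.

(** An element is invertible or nilpotent according to the value of the idempotent
    [(x y) ^ n]. *)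
Lemma pi_regular_stalk (R : comPzRingType) (P : spec R) :
  bezout_locally R ->
  (forall x : R, exists n y, x ^+ n * (1 - x * y) = 0) ->
  concentrated_nilradical (pierce_stalk P).
Proof.
move=> bR piR; apply: unit_or_concentrated.
- exact: pierce_stalk_bezout.
- exact: pierce_stalk_neq0.
move=> x'; have [x <-] := quot_pi_surj x'; have [n [y E]] := piR x.
have {}E : x ^+ n = x ^+ n * (x * y).
  by apply/subr0_eq; rewrite -[X in X - _]mulr1 -mulrBr.
have En m : x ^+ n = x ^+ n * (x * y) ^+ m.
  elim: m => [|m IHm]; first by rewrite mulr1.
  by rewrite exprS mulrA -E.
pose e := (x * y) ^+ n.
have ee : e * e = e.
  rewrite /e {1}exprMn mulrAC -(En n) -exprMn; by [].
case: (pierce_idem P ee) => Epi; [right|left].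
  have /nilp_unit : nilp (quot_pi (pierce_ideal P) x).
    by exists n; rewrite -rmorphXn (En n) rmorphM /= Epi mulr0.
  by [].
have exy : e * (x * y) = e by rewrite /e exprMn mulrAC -E.
exists (quot_pi _ y); rewrite mulrC -rmorphM -[RHS]Epi -[in RHS]exy.
by rewrite [RHS]rmorphM /= Epi mul1r.
Qed.

(** The idempotent generating the annihilator of [x] is [0] or [1] in the stalk. *)
Lemma principal_projective_stalk (R : comPzRingType) (P : spec R) :
  principal_projective R -> concentrated_nilradical (pierce_stalk P).
Proof.
move=> ppR; apply: domain_concentrated; split.
  exact: pierce_stalk_neq0.
move=> x' y'; have [[x <-] [y <-]] := (quot_pi_surj x', quot_pi_surj y').
rewrite -rmorphM => /pierce0[g [gg Pg gxy]].
have [e [ee ex re]] := ppR x; apply/orP.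
have gy : g * y = g * y * e by apply: re; rewrite -mulrA [y * x]mulrC.
have [Pe|Pe] := EM (P e).
  right; apply/eqP; rewrite -[LHS]mul1r -(pierce_idem1 gg Pg) -rmorphM gy.
  by rewrite rmorphM /= (pierce_idem0 ee Pe) mulr0.
left; apply/eqP; rewrite -[LHS]mul1r -(pierce_idem1 ee Pe) -rmorphM ex.
exact: rmorph0.
Qed.

Lemma idem_sim (R : comPzRingType) (P Q : spec R) (e : R) :
  e * e = e -> spec_sim P Q -> ~ P e -> ~ Q e.
Proof.
move=> ee [n [L [<- <- Lstep]]] L0e.
suff : forall k, (k <= n)%N -> ~ L k e by apply.
elim=> [//|k IHk] kn Le; have nLk := IHk (ltnW kn).
have [sub|sub] := Lstep k kn; last exact/nLk/sub.
have : L k (e * (1 - e)).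
  by rewrite mulrBr mulr1 ee subrr; apply: ideal0.
by case/spec_prime => // /sub; apply: spec_subr1.
Qed.

(** The smallest primes under [P] and [Q] consist of zero divisors. If they were
    comaximal, [p + q = 1], then neither [p] nor [p - 1] would be regular in the
    stalk, contradicting almost cleanness; so both lie in a common prime. *)
Lemma almost_clean_sim (R : comPzRingType) (P Q : spec R) :
  bezout_locally R -> almost_clean R -> submod_le (pierce_ideal P) Q ->
  spec_sim P Q.
Proof.
move=> bR acR PQ.
have [N [NP NE]] := generic_prime P bR; have [M [MQ ME]] := generic_prime Q bR.
have [T TE] := ideal_addP N M.
suff T1 : ~ T 1.
  have [L TL _] := maximal_containing T1.
  have NL : submod_le N L.
    move=> x Nx; apply: TL; apply/TE; exists x, 0; rewrite addr0.
    by split=> //; apply: ideal0.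
  have ML : submod_le M L.
    move=> x Mx; apply: TL; apply/TE; exists 0, x; rewrite add0r.
    by split=> //; apply: ideal0.
  exists 4%N, (fun k => nth Q [:: P; N; L; M] k); split=> //.
  case=> [|[|[|[|k]]]] //= _.
  - by right.
  - by left.
  - by right.
  - by left.
case/TE => p [q [/NE[u [k [Pu up]]] /ME[v [m [Qv vq]]] E]].
have [e [r [pE ee regr]]] := acR p.
have reg0 (z : R) i : z * r ^+ i = 0 -> z = 0.
  elim: i => [|i IHi]; first by rewrite expr0 mulr1.
  by rewrite exprSr mulrA mulrC -[X in _ = X -> _](mulr0 r) => /regr/IHi.
have kill (f w z : R) i : w * z ^+ i = 0 -> f * w * (f * z) ^+ i = 0.
  by move=> wz; rewrite exprMn mulrACA wz mulr0.
have [Pe|Pe] := EM (P e).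
  have /(kill (1 - e)) := up.
  have -> : (1 - e) * p = (1 - e) * r.
    by rewrite pE mulrDr mulrBl mul1r ee subrr add0r.
  rewrite exprMn mulrA => /reg0 uc.
  have P1e : ~ P (1 - e) by apply: spec_subr1.
  have PX : ~ P ((1 - e) * u * (1 - e) ^+ k).
    by apply: spec_complM; [exact: spec_complM | move/spec_prime_exp].
  by apply: PX; rewrite uc; apply: ideal0.
have Qe : ~ Q e.
  move/spec_subr1; apply; apply: PQ; exists e.
  by rewrite mulrBr mulr1 ee subrr.
have /(kill e) := vq.
have -> : e * q = - e * r.
  have -> : q = 1 - p by rewrite E addrC addKr.
  by rewrite pE mulrBr mulrDr ee mulr1 opprD addrA subrr add0r mulNr.
rewrite exprMn mulrA => /reg0 ve.
have QX : ~ Q (e * v * (- e) ^+ m).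
  apply: spec_complM; first exact: spec_complM.
  by move/spec_prime_exp/idealN; rewrite opprK.
by apply: QX; rewrite ve; apply: ideal0.
Qed.

Lemma spec_sim_class (R : comPzRingType) (P : spec R) :
  exists P', forall Q, spec_sim P Q <-> spec_sim P' Q.
Proof. by exists P. Qed.

(** Every prime over the Pierce ideal is equivalent to [P], so an element that
    vanishes locally on the class of [P] vanishes locally on the closed set of the
    Pierce ideal, hence on a clopen neighbourhood of it. *)
Lemma pspec_ideal_pierce (R : comPzRingType) (P : spec R) :
  bezout_locally R -> almost_clean R ->
  pspec_ideal (Pspec (spec_sim_class P)) = pierce_ideal P.
Proof.
move=> bR acR; pose A := pspec_ideal (Pspec (spec_sim_class P)).
have AE (x : R) :
    A x <-> forall Q, spec_sim P Q -> loc_of (spec_compl Q) x = 0 by [].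
suff AP (x : R) : A x <-> pierce_ideal P x by apply: submod_ext => x /AP.
rewrite AE; split=> [|[e [ee Pe ex]] Q PQ]; last first.
  apply/fracP; exists e => /=; first exact: idem_sim PQ Pe.
  by rewrite mul0r mulr0 mulr1.
move=> Ax; have [Ann AnnE] := annihilator_idealP x.
have [T TE] := ideal_addP Ann (pierce_ideal P).
suff /TE[u [i [/AnnE ux [e [ee Pe ei]] E]]] : T 1.
  exists e; split=> //; rewrite -[e]mulr1 E mulrDr ei addr0 -mulrA ux.
  exact: mulr0.
apply: ideal_all => Q _ TQ.
have PQ : spec_sim P Q.
  apply: almost_clean_sim => // y Py; apply: TQ; apply/TE; exists 0, y.
  by rewrite add0r; split=> //; apply: ideal0.
have /fracP[u Qu] := Ax Q PQ; rewrite /= mul0r mulr0 mulr1 => ux; apply: Qu.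
apply: TQ; apply/TE; exists u, 0; rewrite addr0; split=> //; last exact: ideal0.
exact/AnnE.
Qed.

Lemma domain_principal_projective (R : comPzRingType) :
  domain R -> principal_projective R.
Proof.
case=> _ intR a; have [->|/eqP a0] := eqVneq a 0.
  by exists 1; split=> [||r _]; rewrite ?mulr1 ?mulr0.
exists 0; split=> [||r /intR/orP[/eqP->|/eqP//]]; by rewrite ?mul0r ?mulr0.
Qed.

(** * Semihereditary rings *)

(** The rows [h i] are the values at [a i] of a splitting of the presentation of
    the ideal generated by [a]. *)
Lemma projective_dual_basis (R : comPzRingType) (I : finType) (a : I -> R) :
  semihereditary R ->
  exists h : I -> I -> R,
    (forall i, a i = \sum_k h i k * a k) /\
    (forall c : I -> R, \sum_i c i * a i = 0 ->
      forall k, \sum_i c i * h i k = 0).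
Proof.
move=> shR; have [K KE] := combination_idealP a.
have fgK : finitely_generated K.
  exact: (@finitely_generated_fin R R^o K I a KE).
have Ka i : K (a i) by apply/KE/mem_combination.
pose A i := sval (submod_elt (Ka i)).
have AE i : \val (A i) = a i := svalP (submod_elt (Ka i)).
pose F := {ffun I -> R^o}.
pose g (x : F) : submod_type K := \sum_i (x i : R) *: A i.
have glin : linear g.
  move=> c x y; rewrite /g scaler_sumr -big_split; apply: eq_bigr => i _.
  by rewrite !ffunE scalerDl scalerA.
pose g' : {linear F -> submod_type K} :=
  HB.pack g (GRing.isLinear.Build R _ _ _ g glin).
have valg (x : F) : \val (g' x) = \sum_i (x i : R) * a i :> R.
  have -> : g' x = \sum_i (x i : R) *: A i by [].
  by rewrite raddf_sum /=; apply: eq_bigr => i _; rewrite AE.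
pose id_K : {linear submod_type K -> submod_type K} := idfun.
have [|h hE] := shR K fgK _ _ g' id_K.
  move=> y; have /submod_predP/KE[c Ec] := valP y.
  exists [ffun i => c i]; apply: val_inj; rewrite valg Ec.
  by apply: eq_bigr => i _; rewrite ffunE.
exists (fun i k => h (A i) k); split=> [i|c ca k].
  by rewrite -valg hE AE.
have : h (\sum_i c i *: A i) = 0.
  suff -> : \sum_i c i *: A i = 0 by rewrite linear0.
  apply: val_inj; rewrite raddf_sum /= -[RHS]ca.
  by apply: eq_bigr => i _; rewrite AE.
rewrite linear_sum => /ffunP/(_ k); rewrite sum_ffunE ffunE => E.
by rewrite -[RHS]E; apply: eq_bigr => i _; rewrite linearZ ffunE.
Qed.

(** The relation [b a = a b] is inherited by the coordinates of [h a] and [h b];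
    the coefficient of [b] in [h b] is then the required multiplier. *)
Lemma semihereditary_bezout_locally (R : comPzRingType) :
  semihereditary R -> bezout_locally R.
Proof.
move=> shR a b.
have [h [hE hrel]] :=
  projective_dual_basis (fun i : bool => if i then b else a) shR.
have rel k : b * h false k = a * h true k.
  have := hrel (fun i => if i then - a else b).
  rewrite big_bool /= mulNr [a * b]mulrC addNr => /(_ erefl k).
  by rewrite big_bool /= mulNr addrC => /subr0_eq.
exists (h true true); split.
  by exists (h false true); rewrite mulrC -rel mulrC.
exists (h true false); have := hE true; rewrite big_bool /= => E.
by rewrite mulrBl mul1r {1}E addrAC subrr add0r.
Qed.

Lemma semihereditary_principal_projective (R : comPzRingType) :
  semihereditary R -> principal_projective R.
Proof.
move=> shR a.
have [h [hE hrel]] := projective_dual_basis (fun _ : 'I_1 => a) shR.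
pose e := h ord0 ord0.
have ea : a = e * a by rewrite [LHS](hE ord0) big_ord1.
have rel (c : R) : c * a = 0 -> c * e = 0.
  move=> ca; have := hrel (fun=> c); rewrite big_ord1 => /(_ ca ord0).
  by rewrite big_ord1.
have c0 : (1 - e) * a = 0 by rewrite mulrBl mul1r -ea subrr.
exists (1 - e); split=> // [|r /rel re].
  by rewrite mulrBr mulr1 (rel _ c0) subr0.
by rewrite mulrBr mulr1 re subr0.
Qed.

(** * Rings of small dimension *)

Definition primes_above_maximal (R : comPzRingType) (A : ideal R) :=
  forall P Q : spec R, submod_le A P -> submod_le P Q -> submod_le Q P.

(** Otherwise a prime over [A] avoids all these elements, and it is not maximal
    since it does not contain [x], which is not invertible modulo it. *)
Lemma primes_above_maximal_pi_regular (R : comPzRingType) (A : ideal R)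
    (x : R) :
  primes_above_maximal A -> exists n y, A (x ^+ n * (1 - x * y)).
Proof.
move=> Amax; apply: contrapT => nA.
have [S SE] : exists S : mulset R,
    forall z : R, S z <-> exists n y, z = x ^+ n * (1 - x * y).
  unshelve eexists
    (@Mulset R (fun z => exists n y, z = x ^+ n * (1 - x * y)) _ _) => //.
  - by exists 0%N, 0; rewrite expr0 mulr0 subr0 mulr1.
  - move=> _ _ [n [y ->]] [m [z ->]].
    by exists (n + m)%N, (y + z - x * y * z); rewrite exprD; ring.
have [z Az /SE[n [y E]]|P [AP PS _]] := @prime_avoiding R A S.
  by apply: nA; exists n, y; rewrite -E.
have Px : ~ P x.
  by move/PS; apply; apply/SE; exists 1%N, 0; rewrite expr1 mulr0 subr0 mulr1.
have [I IE] := ideal_principalP x; have [T TE] := ideal_addP P I.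
have [|Q TQ _] := @maximal_containing R T.
  case/TE=> p [i [Pp /IE[y ->] E]]; apply: (PS p Pp); apply/SE; exists 0%N, y.
  by rewrite expr0 mul1r E mulrC addrK.
apply: Px; apply: (Amax P Q AP) => [z Pz|]; apply: TQ; apply/TE.
  by exists z, 0; rewrite addr0; split=> //; apply: ideal0.
exists 0, x; rewrite add0r; split=> //; first exact: ideal0.
by apply/IE; exists 1; rewrite mul1r.
Qed.
Lemma fp_embed_in_free_bij (R S : comPzRingType) (f : {rmorphism R -> S}) :
  injective f -> (forall y, exists x, f x = y) ->
  fp_embed_in_free S -> fp_embed_in_free R.
Proof.
move=> finj fsurj eS I H a.
have [J [b [ba bv]]] := eS I H (fun i h => f (a i h)).
have [b1 b1E] := choice (fun p : J * I => fsurj (b p.1 p.2)).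
pose b' j i := b1 (j, i); have b'E j i : f (b' j i) = b j i by apply: b1E.
have f0 x : f x = 0 -> x = 0 by move=> E; apply: finj; rewrite E rmorph0.
exists J, b'; split.
  move=> j h; apply: f0; rewrite -[RHS](ba j h) rmorph_sum.
  by apply: eq_bigr => i _; rewrite rmorphM b'E.
move=> v vb; have [|r rE] := bv (fun i => f (v i)).
  move=> j; rewrite -[RHS](rmorph0 f) -(vb j) rmorph_sum.
  by apply: eq_bigr => i _; rewrite rmorphM b'E.
have [r' r'E] := choice (fun h => fsurj (r h)); exists r' => i.
apply: finj; rewrite rE rmorph_sum; apply: eq_bigr => h _.
by rewrite rmorphM r'E.
Qed.

(** When the primes over [A] are maximal, regular elements of [R / A] are
    invertible, so that [R / A] is its own total quotient ring. *)
Lemma quotient_fp_embed_in_free (R : comPzRingType) (A : ideal R) :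
  primes_above_maximal A -> IF_ring (total_quot (ring_quot A)) ->
  fp_embed_in_free (ring_quot A).
Proof.
move=> Amax /IF_fp_embed_in_free; pose S : comPzRingType := ring_quot A.
pose pi : {rmorphism R -> S} := quot_pi A.
apply: (@fp_embed_in_free_bij S _ (loc_of (regular_elements S))).
  by move=> x y /fracP[u ureg /ureg]; rewrite /= !mulr1.
move=> y; have [a [s ->]] := frac_surj y.
have sreg : GRing.lreg (sval s) := denomP s.
have [r rE] := quot_pi_surj (sval s).
have [n [t At]] := primes_above_maximal_pi_regular r Amax.
have unit_s : sval s * pi t = 1.
  have : sval s ^+ n * (1 - sval s * pi t) = 0.
    have <- : pi (r ^+ n * (1 - r * t)) = 0 by apply/quot_pi0.
    by rewrite rmorphM rmorphXn rmorphB rmorphM rmorph1 /= rE.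
  elim: n {At} => [|n IHn]; first by rewrite expr0 mul1r => /subr0_eq ->.
  by rewrite exprS -mulrA -[X in _ = X -> _](mulr0 (sval s)) => /sreg.
exists (a * pi t); apply: (frac_eq (S := regular_elements S)) => /=.
by rewrite mulr1 mulrAC -mulrA unit_s mulr1.
Qed.

Lemma principal_ideal_fg (R : comPzRingType) (a : R) : exists2 A : ideal R,
  finitely_generated A & forall x : R, A x <-> principal a x.
Proof.
have [A AE] := ideal_principalP a; exists A => //.
apply: (@finitely_generated_fin R R^o A 'I_1 (fun=> a)) => x; rewrite AE.
by split=> [[r ->]|[c ->]]; [exists (fun=> r) | exists (c ord0)];
  rewrite big_ord1.
Qed.

(** The intersection of [R x] and [R y] contains [x y] and its image modulo [x y]
    is read off from the syzygies of [x] and [y] there. *)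
Lemma intersection_fg (R : comPzRingType) (A : ideal R) (x y : R) :
  (forall z : R, A z <-> principal (x * y) z) -> syzygies_fg (ring_quot A) ->
  exists2 B : ideal R, finitely_generated B &
    forall z : R, B z <-> principal x z /\ principal y z.
Proof.
move=> AE sA; pose S : comPzRingType := ring_quot A.
pose pi : {rmorphism R -> S} := quot_pi A.
have piE z : pi z = 0 <-> principal (x * y) z.
  by rewrite -AE; apply: quot_pi0.
have [J [b [b0 bc]]] := sA _ (fun i : bool => pi (if i then x else y)).
have [b1 b1E] := choice (fun p : J * bool => quot_pi_surj (b p.1 p.2)).
pose b' j i := b1 (j, i); have b'E j i : pi (b' j i) = b j i by apply: b1E.
have bx j : principal y (b' j true * x).
  have [q Eq] : principal (x * y) (b' j true * x + b' j false * y).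
    apply/piE; rewrite rmorphD !rmorphM /= !b'E.
    by have := b0 j; rewrite big_bool.
  exists (q * x - b' j false); rewrite mulrBl -mulrA -Eq.
  by rewrite addrK.
pose gen (j : 'I_1 + J) :=
  match j with inl _ => x * y | inr j => b' j true * x end.
have [B BE] := combination_idealP gen; exists B.
  exact: (@finitely_generated_fin R R^o B _ gen BE).
move=> z; rewrite BE; split=> [[c ->]|[[p Ep] [q Eq]]].
  have [Ix IxE] := ideal_principalP x; have [Iy IyE] := ideal_principalP y.
  split; [apply/IxE|apply/IyE]; apply: ideal_sum => -[i|j] /=;
    apply: idealM; [apply/IxE|apply/IxE|apply/IyE|apply/IyE].
  - by exists y; rewrite mulrC.
  - by exists (b' j true).
  - by exists x.
  - exact: bx.
have [|d dE] := bc (fun i => pi (if i then p else - q)).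
  rewrite big_bool /= -!rmorphM -rmorphD; apply/piE; exists 0.
  by rewrite mul0r mulNr -Ep -Eq subrr.
have [d' d'E] := choice (fun j => quot_pi_surj (d j)).
have [w Ew] : principal (x * y) (p - \sum_j d' j * b' j true).
  apply/piE; rewrite rmorphB rmorph_sum (dE true); apply/eqP; rewrite subr_eq0.
  by apply/eqP/eq_bigr => j _; rewrite rmorphM b'E -d'E.
exists (fun j => match j with inl _ => w * x | inr j => d' j end).
rewrite big_sumType big_ord1 /= Ep -[p](subrK (\sum_j d' j * b' j true)) Ew.
rewrite mulrDl mulr_suml; congr (_ + _); first by ring.
by apply: eq_bigr => j _; rewrite mulrA.
Qed.

(** Modulo [B], the intersection of [R x] and [R y], the vector [(x, 0)] is
    orthogonal to the syzygies of [(x, y)], hence a multiple of it. *)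
Lemma bezout_of_intersection (R : comPzRingType) (B : ideal R) (x y : R) :
  (forall z : R, B z <-> principal x z /\ principal y z) ->
  fp_embed_in_free (ring_quot B) ->
  exists s, principal y (s * x) /\ principal x ((1 - s) * y).
Proof.
move=> BE eB; pose S : comPzRingType := ring_quot B.
pose pi : {rmorphism R -> S} := quot_pi B.
have piE z : pi z = 0 <-> principal x z /\ principal y z.
  by rewrite -BE; apply: quot_pi0.
have [J [b [b0 bv]]] :=
  fp_embed_in_free_column eB (fun i : bool => pi (if i then x else y)).
have [|r' rE] := bv (fun i => pi (if i then x else 0)).
  move=> j; have := b0 j; rewrite !big_bool /= rmorph0 mulr0 addr0.
  have [p pE] := quot_pi_surj (b j true).
  have [q qE] := quot_pi_surj (b j false).
  have -> : b j true = pi p by [].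
  have -> : b j false = pi q by [].
  rewrite -!rmorphM -rmorphD => /piE[_ [w Ew]]; apply/piE.
  split; first by exists p.
  by exists (w - q); rewrite mulrBl -Ew addrK.
have [r rE'] := quot_pi_surj r'; have {}rE' : pi r = r' by [].
subst r'; exists (1 - r); split.
  have /piE[] // : pi ((1 - r) * x) = 0.
  by rewrite rmorphM rmorphB rmorph1 mulrBl mul1r -(rE true) subrr.
have -> : 1 - (1 - r) = r by rewrite opprB addrC subrK.
have /piE[] // : pi (r * y) = 0.
by rewrite rmorphM -(rE false) rmorph0.
Qed.

(** The quotient by [x y] shows that the intersection of [R x] and [R y] is
    finitely generated; the quotient by that intersection then gives [s]. *)
Lemma finitely_fractionally_IF_bezout_locally (R : comPzRingType) :
  (forall x y : R, x <> 0 -> y <> 0 -> forall A : ideal R, A (x * y) ->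
    primes_above_maximal A) ->
  finitely_fractionally_IF R -> bezout_locally R.
Proof.
move=> Rmax ffR x y.
have dvd0 (z : R) : principal z 0 by exists 0; rewrite mul0r.
have [->|/eqP x0] := eqVneq x 0.
  by exists 1; rewrite mulr0 subrr mul0r.
have [->|/eqP y0] := eqVneq y 0.
  by exists 0; rewrite mulr0 mul0r.
have embed (A : ideal R) : finitely_generated A -> A (x * y) ->
    fp_embed_in_free (ring_quot A).
  move=> fgA Axy; apply: quotient_fp_embed_in_free; last exact: ffR.
  exact: Rmax Axy.
have [A fgA AE] := principal_ideal_fg (x * y).
have [|B fgB BE] := @intersection_fg R A x y AE.
  apply/fp_embed_in_free_syzygies/embed => //.
  by apply/AE; exists 1; rewrite mul1r.
apply: (bezout_of_intersection BE); apply: embed => //.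
by apply/BE; split; [exists y; rewrite mulrC | exists x].
Qed.

Lemma strict_prime_chain (R : comPzRingType) (P Q : spec R) :
  submod_le P Q -> ~ submod_le Q P -> prime_chain R 1.
Proof.
by move=> PQ nQP; exists (fun k => if k is 0%N then P else Q) => -[|k].
Qed.

Lemma krull_dim0_maximal (R : comPzRingType) (A : ideal R) :
  krull_dim R 0 -> primes_above_maximal A.
Proof.
move=> [_ dimR] P Q _ PQ; apply: contrapT => nQP.
by have := dimR 1%N (strict_prime_chain PQ nQP).
Qed.

Lemma domain_dim1_maximal (R : comPzRingType) (A : ideal R) (z : R) :
  domain R -> krull_dim R 1 -> z <> 0 -> A z -> primes_above_maximal A.
Proof.
move=> [R1 intR] [_ dimR] z0 Az P Q AP PQ; apply: contrapT => nQP.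
have [O OE] := zero_idealP R.
have O1 : ~ O 1 by rewrite OE.
have Oprime x y : O (x * y) -> O x \/ O y.
  by rewrite !OE => /intR/orP[/eqP|/eqP]; [left|right].
pose Z := Spec O1 Oprime.
have : prime_chain R 2.
  exists (fun k => match k with 0%N => Z | 1%N => P | _ => Q end).
  case=> [|[|k]] //= _; split=> // [x /OE->|/(_ z (AP z Az))/OE//].
  exact: ideal0.
by move/dimR.
Qed.

Theorem theorem5p11 (R : comPzRingType) :
  (almost_clean R -> coherent R -> arithmetical R ->
   (forall x : pspec R,
      torch_ring (ring_quot (pspec_ideal x))
      \/ local_ring (ring_quot (pspec_ideal x))
      \/ domain (ring_quot (pspec_ideal x))) ->
   finitely_fractionally_IF R)
  /\ (clean R -> coherent R -> arithmetical R -> finitely_fractionally_IF R)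
  /\ (semihereditary R -> finitely_fractionally_IF R)
  /\ (krull_dim R 0 \/ (domain R /\ krull_dim R 1) ->
      (finitely_fractionally_IF R <-> coherent R /\ arithmetical R)).
Proof.
split=> [acR /coherent_syzygies sR /arithmetical_bezout_locally bR HR|].
  apply: stalks_finitely_fractionally_IF => // P.
  have := HR (Pspec (spec_sim_class P)).
  rewrite pspec_ideal_pierce // => -[torch|[loc|dom]].
  - by apply: torch_concentrated => //; apply: pierce_stalk_bezout.
  - by apply: local_concentrated => //; apply: pierce_stalk_bezout.
  - exact: domain_concentrated.
split=> [clR /coherent_syzygies sR /arithmetical_bezout_locally bR|].
  by apply: stalks_finitely_fractionally_IF => // P; apply: clean_stalk.
split=> [shR|].
  have bR := semihereditary_bezout_locally shR.
  have ppR := semihereditary_principal_projective shR.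
  apply: stalks_finitely_fractionally_IF => // [|P].
    exact: principal_projective_syzygies.
  exact: principal_projective_stalk.
move=> dimR; split=> [ffR|[/coherent_syzygies sR]]; last first.
  move/arithmetical_bezout_locally => bR.
  apply: stalks_finitely_fractionally_IF => // P.
  case: dimR => [dim0|[domR _]]; last first.
    exact/principal_projective_stalk/domain_principal_projective.
  apply: pi_regular_stalk => // x; have [A AE] := zero_idealP R.
  have Amax : primes_above_maximal A by apply: krull_dim0_maximal.
  have [n [y /AE]] := primes_above_maximal_pi_regular x Amax.
  by exists n, y.
have bR : bezout_locally R.
  apply: finitely_fractionally_IF_bezout_locally => // x y x0 y0 A Axy.
  case: dimR => [dim0|[domR dim1]]; first exact: krull_dim0_maximal.
  apply: (domain_dim1_maximal domR dim1 _ Axy).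
  by case: domR => _ intR /intR/orP[] /eqP.
split; last exact: bezout_locally_arithmetical.
apply: syzygies_coherent; case: dimR => [dim0|[domR _]]; last first.
  apply: principal_projective_syzygies => //.
  exact: domain_principal_projective.
have [A fgA AE] := principal_ideal_fg (0 : R).
apply: fp_embed_in_free_syzygies.
apply: (@fp_embed_in_free_bij R _ (quot_pi A)); last first.
- by apply: quotient_fp_embed_in_free (ffR A fgA); apply: krull_dim0_maximal.
- exact: quot_pi_surj.
- move=> x y /quot_piP/AE[r]; rewrite mulr0; exact: subr0_eq.
Qed.
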